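(* Let $X$ be a continuous time irreducible, non-explosive Markov chain on a finite or countable state space $S$ with conservative $q$-matrix $Q$, let $D\subset S$, $E=S\setminus D$, $E_\Delta=E\cup\{\Delta\}$, let $T$ be the first passage time of $X$ in $D$, and let $Q^T$ and $P^T(t)$ be the $q$-matrix and transition semigroup of $X$ killed at time $T$. Let $\mu$ be a distribution on $E_\Delta$ (with $\mu_\Delta=0$) such that $\mathbb{P}_\mu(T>t)=e^{-\alpha t}$, $t\ge0$, for some $\alpha>0$, and such that $\mu P^T(t)$ is differentiable with $\frac{d}{dt}\,\mu P^T(t)=\mu\,\frac{d}{dt}P^T(t)$ for $t>0$. If $\mu$ admits a quasi-limiting distribution $\pi$, then $\pi$ is given by $$\pi=\mu+\int_0^{\infty}\big(\mu Q^T+\alpha(\mu-\delta)\big)e^{\alpha t}P^T(t)\,dt,$$ where the integral should be understood as a possibly improper integral. In particular, $\pi$ is a quasi-stationary distribution on $E_\Delta$.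
   Context: Setting. $X=\{(X_t)_{t\ge0},(\mathbb{P}_i)_{i\in S}\}$ is a continuous time irreducible Markov chain with finite or countable state space $S$, transition semigroup $P(t)=\{p_{ij}(t):i,j\in S\}$ and $q$-matrix $Q=\{q_{ij}:i,j\in S\}$, $q_{ij}=p'_{ij}(0)$. It is assumed that $Q$ is conservative, i.e. $\sum_{j\in S}q_{ij}=0$ for all $i\in S$, and that $X$ is non-explosive. $D\subset S$, $E=S\setminus D$, and $T=\inf\{t\ge0:X_t\in D\}$. Killed process. $\Delta$ is a cemetery point, $E_\Delta=E\cup\{\Delta\}$, and $X^T_t=X_t$ if $t<T$, $X^T_t=\Delta$ if $t\ge T$. The killing rates are $\eta_i=\sum_{j\in D}q_{ij}$, $i\in E$. The $q$-matrix $Q^T=(q^T_{ij})_{i,j\in E_\Delta}$ of $X^T$ is given by $q^T_{ij}=q_{ij}$ for $i,j\in E$, $q^T_{i\Delta}=\eta_i$ for $i\in E$, and $q^T_{\Delta j}=0$ for $j\in E_\Delta$. Its transition semigroup $P^T(t)=(p^T_{ij}(t))_{i,j\in E_\Delta}$ is $p^T_{ij}(t)=\mathbb{P}_i(X_t=j,\,t<T)$ for $i,j\in E$; $p^T_{i\Delta}(t)=\mathbb{P}_i(t\ge T)$ for $i\in E$; $p^T_{\Delta j}(t)=1_{j=\Delta}$. The family $(\mathbb{P}_i)_{i\in E}$ is extended to $i=\Delta$ accordingly, and $\mathbb{P}_\mu=\sum_i\mu_i\mathbb{P}_i$. Conventions. All distributions (probability measures) on $E_\Delta$ considered do not charge $\Delta$.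 Distributions are row vectors; products of row vectors and matrices indexed by $E_\Delta$ are given by the usual (possibly infinite) sums; differentiation and integration of vectors and matrices are entrywise. $\delta$ is the vector with $\delta_i=0$ for $i\in E$ and $\delta_\Delta=1$. A distribution $\pi$ on $E_\Delta$ is the quasi-limiting distribution (Yaglom limit) of a distribution $\mu$ on $E_\Delta$ if $\lim_{t\to\infty}\mathbb{P}_\mu(X^T_t=i\mid T>t)=\pi_i$ for all $i\in E_\Delta$. A distribution $\pi$ on $E_\Delta$ is quasi-stationary if $\mathbb{P}_\pi(X^T_t=i\mid T>t)=\pi_i$ for all $t\ge0$ and $i\in E_\Delta$.
   Formalization: The product μQ^T P^T(t) in the integrand is read as μ(Q^T P^T(t)); the printed bracketing (μQ^T)P^T(t), which can be undefined (∞−∞), is proved only when the double series Σ μ_i q^T_ij p^T_jk(t) converges absolutely for all t>0 and k. *)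

(* Defs.v *)
From HB Require Import structures.
From mathcomp Require Import all_boot all_order all_algebra.
From mathcomp Require Import all_classical all_reals all_analysis.

Set Implicit Arguments.
Unset Strict Implicit.
Unset Printing Implicit Defensive.

Import Order.TTheory GRing.Theory Num.Theory.
Import numFieldNormedType.Exports.

Local Open Scope classical_set_scope.
Local Open Scope ring_scope.
Local Open Scope ereal_scope.

(* Sums over a countable index type. All vectors and matrices take values in
   \bar R. As +oo - +oo = -oo in \bar R, [xsum f = r%:E] holds exactly when [f]
   is absolutely summable with sum [r]: no junk value is ever finite. *)
Section Sums.
Variables (R : realType) (I : choiceType).

Definition xsum (f : I -> \bar R) : \bar R :=
  \esum_(i in [set: I]) f^\+ i - \esum_(i in [set: I]) f^\- i.

Definition rowmul (v : I -> \bar R) (M : I -> I -> \bar R) (k : I) : \bar R :=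
  xsum (fun i => v i * M i k).

Definition matmul (M N : I -> I -> \bar R) (i k : I) : \bar R :=
  xsum (fun j => M i j * N j k).

End Sums.

(* E_Delta, for E = S \ D; the cemetery point Delta is None. *)
Notation state D := (option {i | i \in ~` D}).

Section MarkovChain.
Variables (R : realType) (d : measure_display) (Omega : measurableType d).
Variable S : countType.
Variables (P : S -> probability Omega R) (X : R -> Omega -> S).

(* The process is indexed by t >= 0; its values at negative times are never
   used. *)

Definition right_continuous_paths : Prop :=
  forall w t, (0 <= t)%R ->
    exists2 e : R, (0 < e)%R & forall s, (t <= s < t + e)%R -> X s w = X t w.

(* Each element (u, i) of [past] prescribes the value i at the time u <= s. *)
Definition markov_property : Prop :=
  forall (i : S) (past : seq (R * S)) (s t : R) (j k : S),
    (0 <= s)%R -> (0 <= t)%R ->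
    (forall u, u \in past -> (0 <= u.1 <= s)%R) ->
    let past_event := [set w | forall u, u \in past -> X u.1 w = u.2] in
    P i (past_event `&` [set w | X s w = j] `&` [set w | X (s + t)%R w = k]) =
    P i (past_event `&` [set w | X s w = j]) * P j [set w | X t w = k].

Definition irreducible_chain : Prop :=
  forall i j : S, exists2 t : R, (0 <= t)%R & 0 < P i [set w | X t w = j].

Fixpoint jump_time (n : nat) (w : Omega) : \bar R :=
  match n with
  | 0%N => 0
  | m.+1 => match jump_time m w with
            | r%:E => ereal_inf
                [set t%:E | t in [set t : R | (r <= t)%R /\ X t w <> X r w]]
            | _ => +oo
            end
  end.

Definition explosion_time (w : Omega) : \bar R :=
  ereal_sup [set jump_time n w | n in [set: nat]].

Definition non_explosive : Prop :=
  forall i : S, {ae P i, forall w, explosion_time w = +oo}.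

(* The q-matrix is the right derivative at 0 of the transition semigroup; it is
   real-valued, so all states are stable. *)
Definition is_qmatrix (Q : S -> S -> R) : Prop :=
  forall i j : S,
    (fun h : R => ((fine (P i [set w | X h w = j]) - (i == j)%:R) / h)%R)
      @ (0%R : R)^'+ --> Q i j.

Definition conservative (Q : S -> S -> R) : Prop :=
  forall i : S, xsum (fun j => (Q i j)%:E) = 0.

Record markov_chain (Q : S -> S -> R) : Prop := {
  mc_measurable : forall (t : R) (j : S), (0 <= t)%R ->
    measurable [set w | X t w = j] ;
  mc_start : forall i : S, P i [set w | X 0%R w = i] = 1 ;
  mc_paths : right_continuous_paths ;
  mc_markov : markov_property ;
  mc_irreducible : irreducible_chain ;
  mc_non_explosive : non_explosive ;
  mc_qmatrix : is_qmatrix Q ;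
  mc_conservative : conservative Q
}.

Variable D : set S.

Definition passage_time (w : Omega) : \bar R :=
  ereal_inf [set t%:E | t in [set t : R | (0 <= t)%R /\ D (X t w)]].

Local Notation live := {i | i \in ~` D}.
Local Notation state := (state D).

(* For t < T the state X_t lies outside D, so [insub] returns [Some X_t]. *)
Definition killed (t : R) (w : Omega) : state :=
  if t%:E < passage_time w then insub (X t w) else None.

Definition killing_rate (Q : S -> S -> R) (i : live) : \bar R :=
  \esum_(j in D) (Q (val i) j)%:E.

Definition killed_qmatrix (Q : S -> S -> R) (i j : state) : \bar R :=
  match i, j with
  | Some i', Some j' => (Q (val i') (val j'))%:E
  | Some i', None => killing_rate Q i'
  | None, _ => 0
  end.

Definition killed_semigroup (t : R) (i j : state) : \bar R :=
  match i, j with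
  | Some i', Some j' =>
      P (val i') [set w | X t w = val j' /\ t%:E < passage_time w]
  | Some i', None => P (val i') [set w | passage_time w <= t%:E]
  | None, _ => (j == None)%:R%:E
  end.

Definition killed_semigroup_deriv (t : R) (i j : state) : \bar R :=
  (derive1 (fun s : R => fine (killed_semigroup s i j)) t)%:E.

Definition distribution_on (mu : state -> R) : Prop :=
  [/\ forall i, (0 <= mu i)%R, mu None = 0%R &
      \esum_(i in [set: state]) (mu i)%:E = 1].

Definition vec (mu : state -> R) : state -> \bar R := fun i => (mu i)%:E.

(* P_mu, for mu not charging the cemetery point. *)
Definition law (mu : state -> R) (A : set Omega) : \bar R :=
  \esum_(i in [set: live]) ((mu (Some i))%:E * P (val i) A).

Definition survival (t : R) : set Omega := [set w | t%:E < passage_time w].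

Definition cond_law (mu : state -> R) (t : R) (i : state) : R :=
  (fine (law mu ([set w | killed t w = i] `&` survival t)) /
   fine (law mu (survival t)))%R.

Definition quasi_limiting (mu pi : state -> R) : Prop :=
  distribution_on pi /\
  forall i, (fun t : R => cond_law mu t i) @ +oo%R --> pi i.

Definition quasi_stationary (pi : state -> R) : Prop :=
  distribution_on pi /\
  forall (t : R) i, (0 <= t)%R -> cond_law pi t i = pi i.

Definition derivative_commutes (mu : state -> R) : Prop :=
  forall (t : R) (k : state), (0 < t)%R ->
    let f := fun s : R => fine (rowmul (vec mu) (killed_semigroup s) k) in
    derivable f t 1%R /\
    (derive1 f t)%:E = rowmul (vec mu) (killed_semigroup_deriv t) k.

(* alpha (mu - delta), with delta the unit mass at the cemetery point. *)
Definition drift (alpha : R) (mu : state -> R) (j : state) : \bar R :=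
  (alpha * (mu j - (j == None)%:R))%:E.

Definition row_first (Q : S -> S -> R) (alpha : R) (mu : state -> R)
    (t : R) : state -> \bar R :=
  rowmul (fun j => (rowmul (vec mu) (killed_qmatrix Q) j + drift alpha mu j)
                   * (expR (alpha * t))%:E)
         (killed_semigroup t).

(* The same vector with mu Q^T P^T(t) bracketed as mu (Q^T P^T(t)). The two
   bracketings of this triple product can differ when the double series does
   not converge absolutely: in a chain coming down from infinity,
   (mu Q^T) P^T(t) can converge absolutely and yet miss a flux of mass from
   infinity, and mu Q^T can also have infinite entries. *)
Definition matrix_first (Q : S -> S -> R) (alpha : R) (mu : state -> R)
    (t : R) (k : state) : \bar R :=
  (rowmul (vec mu) (matmul (killed_qmatrix Q) (killed_semigroup t)) k
   + rowmul (drift alpha mu) (killed_semigroup t) k)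
  * (expR (alpha * t))%:E.

Definition triple_product_summable (Q : S -> S -> R) (mu : state -> R) : Prop :=
  forall (t : R) (k : state), (0 < t)%R ->
    summable [set: state * state]
      (fun ij => (mu ij.1)%:E * killed_qmatrix Q ij.1 ij.2
                 * killed_semigroup t ij.2 k).

End MarkovChain.

(* The integral of f over [0, +oo), improper at +oo, equals l. *)
Definition improper_integral_is (R : realType) (f : R -> \bar R) (l : R) : Prop :=
  (forall b : R, (0 < b)%R -> (@lebesgue_measure R).-integrable `[0%R, b] f) /\
  (fun b : R => \int[@lebesgue_measure R]_(t in `[0%R, b]) f t) @ +oo%R --> l%:E.

Definition integral_formula (R : realType) (I : Type) (mu pi : I -> R)
    (F : R -> I -> \bar R) : Prop :=
  exists2 J : I -> R, (forall k, improper_integral_is (fun t => F t k) (J k)) &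
    forall k, pi k = (mu k + J k)%R.

(* Main.v *)
Require Import Defs.
From mathcomp Require Import all_boot all_order all_algebra.
From mathcomp Require Import all_classical all_reals all_analysis.
From mathcomp Require Import measurable_realfun lra ring.

(* Write p_ij(t) = P_i(X_t = j, t < T) for the killed transition probabilities.
   Right-continuity turns {t < T} into a decreasing limit of events on dyadic
   grids, whence the Chapman-Kolmogorov equation for p and the bounds
   p_ij(h) >= h q_ij (1 + h q_ii + h q_jj) and p_ii(h) >= 1 + h q_ii. As Q is
   conservative, these bounds and Pratt's lemma give the backward equation
   dP^T/dt = Q^T P^T.
   Let f_k(t) be the k-th entry of mu P^T(t), with k in E. By the backward
   equation and the hypothesis on mu, the integrand is the derivative of
   e^(alpha t) f_k(t). It could a priori fail to be integrable near a point, but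
   p_ik' - q_kk p_ik >= 0 for every i, so that it is the difference of two series
   of nonnegative continuous functions, which are integrated termwise. Thus the
   integral over [0, b] is e^(alpha b) f_k(b) - mu_k, which tends to pi_k - mu_k.
   The entry at Delta vanishes identically.
   Finally e^(alpha s) f(s) tends to pi entrywise and both have mass 1, so the
   convergence holds in total variation, and e^(alpha s) mu P^T(s + t) tends both
   to pi P^T(t) and to e^(-alpha t) pi on E. *)

Set Implicit Arguments.
Unset Strict Implicit.
Unset Printing Implicit Defensive.

Import Order.TTheory GRing.Theory Num.Theory.
Import numFieldNormedType.Exports.

Local Open Scope classical_set_scope.
Local Open Scope ring_scope.

(** * Absolutely convergent sums over a countable type *)

(** The hypothesis on [mu] identifies the derivative of [f_k] pointwise for [t > 0], but gives
    neither its continuity nor a local bound. The fundamental theorem of calculus is therefore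
    applied to each [p_ik], whose derivative is continuous, and the series is summed afterwards. The
    one-sided bound that permits this comes from waiting in [k] at the end: [p_ik(t + h) >= p_ik(t)
    p_kk(h) >= p_ik(t) (1 + h q_kk)]. Dominated convergence does not suffice for the backward
    equation: the natural majorant of [p_ij(h) / h] is the unkilled [P_i(X_h = j) / h], which moves
    with [h]. Conservativity says exactly that its off-diagonal mass converges to the sum of its
    limits, so that no rate is lost. The same mechanism serves at the end, where the moving majorant
    [e^(alpha s) f_k(s)] has mass 1 for every [s], as has [pi]. The bracketing [mu (Q^T P^T(t))] is
    the primary one because the backward equation evaluates [Q^T P^T(t)] first; the other bracketing
    is reached from it by Fubini when the double series converges absolutely. *)

Section HasSum.
Variables (R : realType) (I : choiceType).
Implicit Types (f g a b : I -> R) (r s : R).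

Definition has_sum f r : Prop := xsum (fun i => (f i)%:E) = r%:E.

Lemma ge0_xsum (h : I -> \bar R) : (forall i, 0 <= h i)%E ->
  xsum h = (\esum_(i in [set: I]) h i)%E.
Proof.
move=> h0; rewrite /xsum [X in (_ - X)%E](_ : _ = 0%E) ?sube0; last first.
  by rewrite esum1// => x _; rewrite /= funenegE; apply/max_idPr;
    rewrite oppe_le0.
by apply: eq_esum => i _; rewrite funeposE; apply/max_idPl.
Qed.

Lemma ge0_has_sumE f r : (forall i, 0 <= f i) ->
  has_sum f r <-> (\esum_(i in [set: I]) (f i)%:E)%E = r%:E.
Proof. by move=> f0; rewrite /has_sum ge0_xsum// => i; rewrite lee_fin. Qed.

Lemma eq_has_sum f g r : f =1 g -> has_sum f r -> has_sum g r.
Proof. by move=> /funext ->. Qed.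

Lemma has_sum_unique f r s : has_sum f r -> has_sum f s -> r = s.
Proof. by rewrite /has_sum => -> []. Qed.

Lemma esum_fin_ge0 (h : I -> \bar R) : (forall i, 0 <= h i)%E ->
  ((\esum_(i in [set: I]) h i)%E < +oo)%E ->
  exists r, (\esum_(i in [set: I]) h i)%E = r%:E.
Proof.
move=> h0 hoo; exists (fine (\esum_(i in [set: I]) h i)); rewrite fineK//.
by rewrite ge0_fin_numE// esum_ge0.
Qed.

Lemma has_sum_sub a b r s : (forall i, 0 <= a i) -> (forall i, 0 <= b i) ->
  has_sum a r -> has_sum b s -> has_sum (fun i => a i - b i) (r - s).
Proof.
move=> a0 b0 /(ge0_has_sumE _ a0) ar /(ge0_has_sumE _ b0) bs.
rewrite /has_sum /xsum EFinB -ar -bs.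
rewrite -(@esumB R I setT (fun i => (a i)%:E) (fun i => (b i)%:E))//.
- by rewrite /summable; under eq_esum do rewrite gee0_abs ?lee_fin//;
  rewrite ?ar ltry.
- by rewrite /summable; under eq_esum do rewrite gee0_abs ?lee_fin//;
  rewrite bs ltry.
- by move=> i _; rewrite lee_fin.
- by move=> i _; rewrite lee_fin.
Qed.

(** A finite difference forces both parts to be finite, since [+oo - +oo] is [-oo] and not a real.
    This splitting reduces the signed statements below to nonnegative sums; the identity for the
    absolute value gives absolute summability. *)
Lemma has_sum_posneg f r : has_sum f r ->
  exists a b A B, [/\ (forall i, 0 <= a i), (forall i, 0 <= b i),
    has_sum a A, has_sum b B & f =1 (fun i => a i - b i)
    /\ (fun i => `|f i|) =1 (fun i => a i + b i)].
Proof.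
move=> fr; rewrite /has_sum /xsum in fr.
pose F i := (f i)%:E.
have p0 i : (0 <= F^\+ i)%E by rewrite funeposE le_max lexx orbT.
have n0 i : (0 <= F^\- i)%E by rewrite funenegE le_max lexx orbT.
have pE i : (F^\+)%E i = (Num.max (f i) 0)%:E by rewrite funeposE -EFin_max.
have nE i : (F^\-)%E i = (Num.max (- f i) 0)%:E by rewrite funenegE -EFin_max.
have P0 : (0 <= \esum_(i in [set: I]) F^\+ i)%E by apply: esum_ge0 => i _.
have N0 : (0 <= \esum_(i in [set: I]) F^\- i)%E by apply: esum_ge0 => i _.
have [A [B [PA NB]]] : exists A B, (\esum_(i in [set: I]) F^\+ i)%E = A%:E /\
    (\esum_(i in [set: I]) F^\- i)%E = B%:E.
  move: fr P0 N0; rewrite -/F.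
  case: (\esum_(i in [set: I]) F^\+ i)%E => [A| |];
  case: (\esum_(i in [set: I]) F^\- i)%E => [B| |] //=.
  by move=> _ _ _; exists A, B.
exists (fun i => Num.max (f i) 0), (fun i => Num.max (- f i) 0), A, B; split.
- by move=> i; rewrite le_max lexx orbT.
- by move=> i; rewrite le_max lexx orbT.
- rewrite ge0_has_sumE -?PA; first by apply: eq_esum => i _; rewrite pE.
  by move=> i; rewrite le_max lexx orbT.
- rewrite ge0_has_sumE -?NB; first by apply: eq_esum => i _; rewrite nE.
  by move=> i; rewrite le_max lexx orbT.
split=> i /=; case: (leP (f i) 0) => fi; case: (leP (- f i) 0) => gi; try lra.
- have -> : f i = 0 by lra.
  by rewrite normr0 addr0.
- by rewrite ler0_norm//; lra.
- by rewrite gtr0_norm//; lra.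
Qed.

Lemma ge0_has_sumD a b r s : (forall i, 0 <= a i) -> (forall i, 0 <= b i) ->
  has_sum a r -> has_sum b s -> has_sum (fun i => a i + b i) (r + s).
Proof.
move=> a0 b0 /(ge0_has_sumE _ a0) ar /(ge0_has_sumE _ b0) bs.
rewrite ge0_has_sumE; last by move=> i; rewrite addr_ge0.
by rewrite EFinD -ar -bs -esumD// => i _; rewrite lee_fin.
Qed.

Lemma has_sumD f g r s :
  has_sum f r -> has_sum g s -> has_sum (fun i => f i + g i) (r + s).
Proof.
move=> fr gs.
have [a [b [A [B [a0 b0 aA bB [fE _]]]]]] := has_sum_posneg fr.
have [a' [b' [A' [B' [a'0 b'0 aA' bB' [gE _]]]]]] := has_sum_posneg gs.
have -> : r = A - B.
  by apply: (has_sum_unique fr); apply: eq_has_sum (has_sum_sub a0 b0 aA bB) =>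
    i.
have -> : s = A' - B'.
  by apply: (has_sum_unique gs); apply: eq_has_sum (has_sum_sub a'0 b'0 aA' bB')
    => i.
have -> : A - B + (A' - B') = (A + A') - (B + B') by ring.
apply: eq_has_sum (has_sum_sub _ _ (ge0_has_sumD a0 a'0 aA aA') (ge0_has_sumD b0
  b'0 bB bB')).
- by move=> i /=; rewrite fE gE; ring.
- by move=> i; rewrite addr_ge0.
- by move=> i; rewrite addr_ge0.
Qed.

Lemma has_sumN f r : has_sum f r -> has_sum (fun i => - f i) (- r).
Proof.
move=> fr; have [a [b [A [B [a0 b0 aA bB [fE _]]]]]] := has_sum_posneg fr.
have -> : r = A - B.
  by apply: (has_sum_unique fr); apply: eq_has_sum (has_sum_sub a0 b0 aA bB) =>
    i.
rewrite opprB; apply: eq_has_sum (has_sum_sub b0 a0 bB aA) => i.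
by rewrite fE opprB.
Qed.

Lemma has_sumB f g r s :
  has_sum f r -> has_sum g s -> has_sum (fun i => f i - g i) (r - s).
Proof. by move=> fr /has_sumN gs; exact: has_sumD. Qed.

Lemma has_sum0 : has_sum (fun=> 0) 0.
Proof. by rewrite ge0_has_sumE// esum1. Qed.

Lemma ge0_has_sum_ge0 f r : (forall i, 0 <= f i) -> has_sum f r -> 0 <= r.
Proof.
move=> f0 /(ge0_has_sumE _ f0) fr; rewrite -lee_fin -fr.
by apply: esum_ge0 => i _; rewrite lee_fin.
Qed.

Lemma le_has_sum f g r s : (forall i, f i <= g i) ->
  has_sum f r -> has_sum g s -> r <= s.
Proof.
move=> fg fr gs; rewrite -subr_ge0; apply: (ge0_has_sum_ge0 _ (has_sumB gs fr)).
by move=> i; rewrite subr_ge0.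
Qed.

Lemma ge0_dominated_has_sum f g s : (forall i, 0 <= f i <= g i) ->
  has_sum g s -> exists r, has_sum f r.
Proof.
move=> fg gs.
have f0 i : 0 <= f i by case/andP: (fg i).
have g0 i : 0 <= g i by case/andP: (fg i) => /le_trans; apply.
case: (@esum_fin_ge0 (fun i => (f i)%:E)) => [i||r]; first by rewrite lee_fin.
  move/(ge0_has_sumE _ g0): gs => gs.
  apply: (@le_lt_trans _ _ s%:E); last exact: ltry.
  by rewrite -gs; apply: le_esum => i _; rewrite lee_fin; case/andP: (fg i).
by exists r; apply/ge0_has_sumE.
Qed.

Lemma has_sum_norm f r : has_sum f r -> exists s, has_sum (fun i => `|f i|) s.
Proof.
move=> fr; have [a [b [A [B [a0 b0 aA bB [_ fE]]]]]] := has_sum_posneg fr.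
exists (A + B); apply: eq_has_sum (ge0_has_sumD a0 b0 aA bB) => i.
by rewrite fE.
Qed.

(** [f] is the difference of [|f|] and [|f| - f], which are nonnegative and dominated by [g] and
    [2 |f|]. *)
Lemma dominated_has_sum f g s : (forall i, `|f i| <= g i) ->
  has_sum g s -> exists r, has_sum f r.
Proof.
move=> fg gs.
have [i|r1 f1] := @ge0_dominated_has_sum (fun i => `|f i|) _ _ _ gs.
  by rewrite normr_ge0 fg.
have [i|r2 f2] := @ge0_dominated_has_sum (fun i =>
  `|f i| - f i) _ _ _ (has_sumD f1 f1).
  by have := ler_norm (f i); have := ler_norm (- f i); rewrite normrN; lra.
exists (r1 - r2); apply: eq_has_sum (has_sumB f1 f2) => i.
by rewrite opprB addrC subrK.
Qed.

Lemma has_sum_le_seq f r (s : seq I) : (forall i, 0 <= f i) -> has_sum f r ->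
  uniq s -> \sum_(i <- s) f i <= r.
Proof.
move=> f0 /(ge0_has_sumE _ f0) fr us; rewrite -lee_fin -fr -sumEFin.
apply: esum_ge; exists [set` s]; first by split => //; exact: finite_seq.
by rewrite fsbig_seq.
Qed.

(** For a nonnegative family, bounding finite partial sums gives only one inequality ([leZ]). The
    other is the same inequality for the factor [c^-1] applied to the scaled family. Signs are then
    restored through the positive and negative parts. *)
Lemma has_sumZ k f r : has_sum f r -> has_sum (fun i => k * f i) (k * r).
Proof.
have ge0Z (c : R) a s : 0 <= c -> (forall i, 0 <= a i) -> has_sum a s ->
    has_sum (fun i => c * a i) (c * s).
  have leZ (k' : R) b t : 0 <= k' -> (forall i, 0 <= b i) -> has_sum b t ->
      exists2 u, has_sum (fun i => k' * b i) u & u <= k' * t.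
    move=> k0 b0 bt.
    have kb0 i : 0 <= k' * b i by rewrite mulr_ge0.
    have le : (\esum_(i in [set: I]) (k' * b i)%:E <= (k' * t)%:E)%E.
      apply: ge_ereal_sup => _ [X [fX _] <-];
        rewrite fsbig_finite// sumEFin lee_fin.
      by rewrite -mulr_sumr ler_wpM2l// has_sum_le_seq//; exact: fset_uniq.
    case: (@esum_fin_ge0 (fun i => (k' * b i)%:E)) => [i||u uE].
    - by rewrite lee_fin.
    - by apply: le_lt_trans le _; rewrite ltry.
    - by exists u; [exact/ge0_has_sumE|rewrite -lee_fin -uE].
  rewrite le_eqVlt => /predU1P[<- _ _|c0 a0 as_].
    by rewrite mul0r; apply: eq_has_sum has_sum0 => i; rewrite mul0r.
  have [u ua uc] := leZ _ _ _ (ltW c0) a0 as_.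
  have ca0 i : 0 <= c * a i by rewrite mulr_ge0// ltW.
  have ci0 : 0 <= c^-1 by rewrite invr_ge0 ltW.
  have [v va vc] := leZ _ _ _ ci0 ca0 ua.
  have vs : v = s.
    by apply: (has_sum_unique va); apply: eq_has_sum as_ => i;
      rewrite mulKf// gt_eqF.
  suff <- : u = c * s by [].
  by apply/eqP; rewrite eq_le uc/= -ler_pdivlMl// -vs.
have ge0Z' (c : R) : 0 <= c -> has_sum f r -> has_sum (fun i =>
  c * f i) (c * r).
  move=> c0 fr; have [a [b [A [B [a0 b0 aA bB [fE _]]]]]] := has_sum_posneg fr.
  have -> : r = A - B.
    by apply: (has_sum_unique fr); apply: eq_has_sum (has_sum_sub a0 b0 aA bB)
      => i.
  rewrite mulrBr.
  apply: eq_has_sum (has_sumB (ge0Z _ _ _ c0 a0 aA) (ge0Z _ _ _ c0 b0 bB)) => i.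
  by rewrite fE mulrBr.
move=> fr; have [k0|k0] := leP 0 k; first exact: ge0Z'.
have := has_sumN (ge0Z' (- k) _ fr); rewrite mulNr opprK => /(_ _).
move=> h; apply: eq_has_sum (h _); last by rewrite oppr_ge0 ltW.
by move=> i; rewrite mulNr opprK.
Qed.

Lemma has_sum_approx f r (e : R) : (forall i, 0 <= f i) -> has_sum f r ->
  0 < e -> exists s : seq I, r - e < \sum_(i <- s) f i /\ uniq s.
Proof.
move=> f0 /(ge0_has_sumE _ f0) fr e0.
have : ((r - e)%:E < \esum_(i in [set: I]) (f i)%:E)%E.
  by rewrite fr lte_fin; lra.
move=> /ereal_sup_gt[_ [X [fX _] <-]]; rewrite fsbig_finite// sumEFin lte_fin.
by move=> h; exists (finmap.enum_fset (fset_set X)); split => //;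
  exact: fset_uniq.
Qed.

Lemma has_sum1 (i0 : I) f : (forall i, i != i0 -> f i = 0) -> has_sum f (f i0).
Proof.
have pos (c : R) : 0 <= c -> has_sum (fun i => if i == i0 then c else 0) c.
  move=> c0; rewrite ge0_has_sumE; last by move=> i; case: ifP.
  rewrite -[RHS](@esum_set1 R I i0 (fun=> c%:E)) ?lee_fin// [RHS]esum_mkcond.
  apply: eq_esum => i _; rewrite in_set1; case: eqVneq => //.
move=> f0; have [h|/ltW h] := leP 0 (f i0).
  by apply: eq_has_sum (pos _ h) => i; case: eqVneq => [->//|/f0].
have h' : 0 <= - f i0 by lra.
have := has_sumN (pos _ h'); rewrite opprK; apply: eq_has_sum => i.
by case: eqVneq => [->|/f0 ->]; rewrite ?opprK ?oppr0.
Qed.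

Lemma has_sum_ge_term f r i0 : (forall i, 0 <= f i) -> has_sum f r -> f i0 <= r.
Proof.
move=> f0 fr; have := @has_sum_le_seq f r [:: i0] f0 fr isT.
by rewrite big_seq1.
Qed.

Lemma has_sum_remove f r i0 : has_sum f r ->
  has_sum (fun i => if i == i0 then 0 else f i) (r - f i0).
Proof.
move=> fr.
have h : has_sum (fun i => if i == i0 then f i else 0) (f i0).
  by have := @has_sum1 i0 (fun i => if i == i0 then f i else 0); rewrite eqxx;
    apply=> i /negbTE ->.
by apply: eq_has_sum (has_sumB fr h) => i; case: eqVneq => [->|];
  rewrite ?subrr ?subr0.
Qed.

(* Pratt's lemma: the dominating family may vary with the parameter. *)
Lemma pratt (U : Type) (F : set_system U) (a c : U -> I -> R) (A C : U -> R)
    (a0 c0 : I -> R) (A0 C0 : R) : ProperFilter F ->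
  (\forall u \near F, [/\ forall i, 0 <= c u i <= a u i,
      has_sum (a u) (A u) & has_sum (c u) (C u)]) ->
  (forall i, a ^~ i @ F --> a0 i) -> (forall i, c ^~ i @ F --> c0 i) ->
  A @ F --> A0 -> has_sum a0 A0 -> has_sum c0 C0 -> C @ F --> C0.
Proof.
move=> FF near_ac aa0 cc0 AA0 a0A0 c0C0.
(* Fatou's lemma: a finite partial sum exhausts [B0] up to [e], and finite sums pass to the
   limit. *)
have fatou (b : U -> I -> R) (B : U -> R) b0 B0 (e : R) :
    (\forall u \near F, (forall i, 0 <= b u i) /\ has_sum (b u) (B u)) ->
    (forall i, 0 <= b0 i) ->
    (forall i, b ^~ i @ F --> b0 i) -> has_sum b0 B0 -> 0 < e ->
    \forall u \near F, B0 - e < B u.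
  move=> nb b00 bb0 b0B0 e0.
  have [s [lts us]] := has_sum_approx b00 b0B0 e0.
  have cvs : (fun u => \sum_(i <- s) b u i) @ F --> \sum_(i <- s) b0 i.
    by apply: cvg_big => //; exact: add_continuous.
  have lim : \forall u \near F, B0 - e < \sum_(i <- s) b u i.
    exact: cvgr_gt cvs _ lts.
  near=> u; have [b0' bB] : (forall i, 0 <= b u i) /\ has_sum (b u) (B u)
    by near: u.
  apply: lt_le_trans (has_sum_le_seq b0' bB us).
  by near: u.
have c00 i : 0 <= c0 i.
  apply: (cvgr_to_ge (cc0 i)); apply: filterS near_ac => u [cau _ _].
  by case/andP: (cau i).
have ca0 i : 0 <= a0 i - c0 i.
  apply: (cvgr_to_ge (cvgB (aa0 i) (cc0 i))).
  near=> u; have [cau _ _] : [/\ forall i, 0 <= c u i <= a u i,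
      has_sum (a u) (A u) & has_sum (c u) (C u)] by near: u.
  by rewrite subr_ge0; case/andP: (cau i).
apply/cvgrPdist_lt => e e0.
have e20 : 0 < e / 2 by rewrite divr_gt0.
have hc : \forall u \near F, C0 - e < C u.
  apply: (fatou c) => //; apply: filterS near_ac => u [cau _ cC]; split => // i.
  by case/andP: (cau i).
(* Fatou for [c] bounds [C] from below; Fatou for [a - c], together with the convergence of [A],
   bounds it from above. *)
have ha : \forall u \near F, A0 - C0 - e / 2 < A u - C u.
  apply: (fatou (fun u i => a u i - c u i) _ (fun i => a0 i - c0 i)) => //.
  - apply: filterS near_ac => u [cau aA cC]; split; last exact: has_sumB.
    by move=> i; rewrite subr_ge0; case/andP: (cau i).
  - by move=> i; apply: cvgB.
  - exact: has_sumB.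
have hA : \forall u \near F, A u < A0 + e / 2.
  by apply: cvgr_lt AA0 _ _; lra.
near=> u.
have h1 : C0 - e < C u by near: u.
have h2 : A0 - C0 - e / 2 < A u - C u by near: u.
have h3 : A u < A0 + e / 2 by near: u.
by rewrite distrC ltr_distl; apply/andP; split; lra.
Unshelve. all: by end_near.
Qed.

End HasSum.

(** * Reindexing of sums along injections *)

Lemma esum_inj (R : realType) (J K : choiceType) (e : J -> K) (h : K ->
  \bar R) :
  injective e -> (forall k, ~ range e k -> h k = 0%E) ->
  (\esum_(k in [set: K]) h k)%E = (\esum_(j in [set: J]) h (e j))%E.
Proof.
move=> ei h0; rewrite -(esum_image [set: J] e); last by move=> x y _ _;
  exact: ei.
rewrite [RHS]esum_mkcond; apply: eq_esum => k _.
by case: ifPn => // /negP; rewrite inE => /h0.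
Qed.

(** It moves sums between [S], the states outside [D] and [E_Delta], whenever the terms left out
    vanish. *)
Lemma has_sum_inj (R : realType) (J K : choiceType) (e : J -> K) (f : K ->
  R) r :
  injective e -> (forall k, ~ range e k -> f k = 0) ->
  has_sum (f \o e) r <-> has_sum f r.
Proof.
move=> ei f0; rewrite /has_sum.
suff -> : xsum (fun k => (f k)%:E) = xsum (fun j => ((f \o e) j)%:E) by [].
rewrite /xsum (esum_inj ei (h := ((fun k => (f k)%:E)^\+)%E)); last first.
  by move=> k /f0; rewrite funeposE => ->; rewrite maxxx.
rewrite (esum_inj ei (h := ((fun k => (f k)%:E)^\-)%E))//; last first.
  by move=> k /f0; rewrite funenegE => ->; rewrite oppe0 maxxx.
by congr (_ - _)%E; apply: eq_esum => j _; rewrite ?funeposE ?funenegE.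
Qed.

(** * Double sums: Fubini and Tonelli *)

Section Fubini.
Variables (R : realType) (I J : choiceType).

Lemma ge0_has_sum_pair (f : I * J -> R) s : (forall p, 0 <= f p) ->
  has_sum f s ->
  exists r, (forall i, has_sum (fun j => f (i, j)) (r i)) /\ has_sum r s.
Proof.
move=> f0 /(ge0_has_sumE _ f0) fs.
have f0' i j : (0 <= (f (i, j))%:E)%E by rewrite lee_fin.
have E : (\esum_(i in [set: I]) \esum_(j in [set: J]) (f (i, j))%:E = s%:E)%E.
  rewrite (esum_esum (a := fun i j => (f (i, j))%:E))// -fs.
  have -> : [set: I] `*`` (fun=> [set: J]) = [set: I * J] by apply/seteqP;
    split.
  by apply: eq_esum => -[].
(* Each inner sum is finite because the sum of all the inner sums is. *)
have h i : (\esum_(j in [set: J]) (f (i, j))%:E)%E \is a fin_num.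
  rewrite fin_num_abs; apply: (@summable_pinfty I R setT
    (fun i => \esum_(j in [set: J]) (f (i, j))%:E)%E _ i) => //.
  rewrite /summable; under eq_esum do rewrite gee0_abs ?esum_ge0//.
  by rewrite E ltry.
exists (fun i => fine (\esum_(j in [set: J]) (f (i, j))%:E)); split=> [i|].
  by apply/ge0_has_sumE => //; rewrite fineK.
apply/ge0_has_sumE => [i|]; first by rewrite fine_ge0// esum_ge0.
by rewrite -E; apply: eq_esum => i _; rewrite fineK.
Qed.

(** Only this direction is available for signed terms; the passage from iterated sums to pairs,
    [ge0_has_sum_pairI], relies on nonnegativity. *)
Lemma has_sum_pair (f : I * J -> R) s : has_sum f s ->
  exists r, (forall i, has_sum (fun j => f (i, j)) (r i)) /\ has_sum r s.
Proof.
move=> fs; have [a [b [A [B [a0 b0 aA bB [fE _]]]]]] := has_sum_posneg fs.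
have [ra [ra1 ra2]] := ge0_has_sum_pair a0 aA.
have [rb [rb1 rb2]] := ge0_has_sum_pair b0 bB.
exists (fun i => ra i - rb i); split=> [i|].
  by apply: eq_has_sum (has_sumB (ra1 i) (rb1 i)) => j; rewrite fE.
suff -> : s = A - B by exact: has_sumB.
by apply: (has_sum_unique fs); apply: eq_has_sum (has_sumB aA bB) => i;
  rewrite fE.
Qed.

Lemma ge0_has_sum_pairI (f : I -> J -> R) r s : (forall i j, 0 <= f i j) ->
  (forall i, has_sum (f i) (r i)) -> has_sum r s ->
  has_sum (fun p => f p.1 p.2) s.
Proof.
move=> f0 fr rs; have r0 i : 0 <= r i by apply: ge0_has_sum_ge0 (fr i).
apply/ge0_has_sumE => // ; move/(ge0_has_sumE _ r0): rs => <-.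
have -> : [set: I * J] = [set: I] `*`` (fun=> [set: J]) by apply/seteqP; split.
rewrite -(esum_esum (a := fun i j => (f i j)%:E))//; last by move=> *;
  rewrite lee_fin.
by apply: eq_esum => i _; apply/ge0_has_sumE.
Qed.

End Fubini.

Lemma has_sum_swap (R : realType) (I J : choiceType) (f : I * J -> R) s :
  has_sum f s -> has_sum (fun p : J * I => f (p.2, p.1)) s.
Proof.
move=> fs; apply: (iffRL (@has_sum_inj R _ _ (fun p : J * I =>
  (p.2, p.1)) f s _ _)).
- by move=> [a b] [a' b'] /= [-> ->].
- by move=> [i j] []; exists (j, i).
- exact: fs.
Qed.

Lemma ge0_has_sum_exchange (R : realType) (I J : choiceType) (f : I -> J ->
  R) r c s :
  (forall i j, 0 <= f i j) -> (forall i, has_sum (f i) (r i)) ->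
  (forall j, has_sum (f ^~ j) (c j)) -> has_sum r s -> has_sum c s.
Proof.
move=> f0 fr fc rs.
have [c' [c1 c2]] := has_sum_pair (has_sum_swap (ge0_has_sum_pairI f0 fr rs)).
by apply: eq_has_sum c2 => j; apply: has_sum_unique (c1 j) (fc j).
Qed.

Lemma has_sum_option (R : realType) (I : choiceType) (f : option I -> R) r :
  has_sum (fun i => f (Some i)) r -> has_sum f (f None + r).
Proof.
move=> fr.
have h1 : has_sum (fun x : option I => if x is Some _ then 0 else f None) (f
  None).
  pose g (x : option I) := if x is Some _ then 0 else f None.
  by apply: (@has_sum1 R _ None g); case.
have h2 : has_sum (fun x : option I => if x is Some i then f (Some i) else 0) r.
  apply: (iffLR (@has_sum_inj R _ _ Some _ r _ _)) => //.
  by case=> [k nk|//]; exfalso; apply: nk; exists k.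
by apply: eq_has_sum (has_sumD h1 h2) => -[i|] /=; rewrite ?add0r ?addr0.
Qed.

(** Enumeration by codes, with the value 0 at the codes of no element, makes the monotone
    convergence and sigma-additivity results for series over [nat] applicable to a countable index
    type. *)
Lemma esum_countE (R : realType) (I : countType) (h : I -> \bar R) :
  (forall i, 0 <= h i)%E ->
  (\esum_(i in [set: I]) h i = \sum_(n <oo) oapp h 0 (pickle_inv n))%E.
Proof.
move=> h0; rewrite nneseries_esumT; last by move=> n; case: pickle_inv.
rewrite [RHS](esum_inj (e := @pickle I)); last 2 first.
- exact: (pcan_inj pickleK).
- move=> n nP; case E : (pickle_inv n) => [x|//]; exfalso; apply: nP.
  by exists x => //; have := @pickle_invK I n; rewrite E.
by apply: eq_esum => i _; rewrite pickleK_inv.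
Qed.

Lemma ge0_integral_esum d (T : measurableType d) (R : realType)
    (mu : {measure set T -> \bar R}) (D : set T) (I : countType)
    (f : I -> T -> \bar R) : measurable D ->
  (forall i, measurable_fun D (f i)) -> (forall i x, D x -> (0 <= f i x)%E) ->
  (\int[mu]_(x in D) (\esum_(i in [set: I]) f i x) =
   \esum_(i in [set: I]) (\int[mu]_(x in D) f i x))%E.
Proof.
move=> mD mf f0.
rewrite esum_countE; last by move=> i; apply: integral_ge0 => x; exact: f0.
transitivity (\int[mu]_(x in D) (\sum_(n <oo) oapp (f ^~ x) 0 (@pickle_inv I
  n)))%E.
  by apply: eq_integral => x /set_mem Dx; rewrite esum_countE// => i; exact: f0.
rewrite (@integral_nneseries _ _ _ mu D mD (fun n x =>
  oapp (f ^~ x) 0%E (@pickle_inv I n))).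
- by apply: eq_eseriesr => n _; case: pickle_inv => //=; rewrite integral0.
- by move=> n; case: pickle_inv => //=; exact: measurable_cst.
- by move=> n x Dx; case: pickle_inv => //= i; exact: f0.
Qed.

Lemma measurable_esum d (T : measurableType d) (R : realType) (D : set T)
    (I : countType) (f : I -> T -> \bar R) :
  (forall i, measurable_fun D (f i)) -> (forall i x, D x -> (0 <= f i x)%E) ->
  measurable_fun D (fun x => \esum_(i in [set: I]) f i x)%E.
Proof.
move=> mf f0.
apply: (eq_measurable_fun (fun x => \sum_(n <oo) oapp (f ^~ x) 0 (@pickle_inv I
  n)))%E.
  by move=> x /set_mem Dx; rewrite esum_countE// => i; exact: f0.
apply: ge0_emeasurable_sum.
- by move=> n x Dx _; case: pickle_inv => //= i; exact: f0.
- by move=> n _; case: pickle_inv => //=; exact: measurable_cst.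
Qed.

Lemma measure_esum d (T : measurableType d) (R : realType)
    (mu : {measure set T -> \bar R}) (I : countType) (f : T ->
      I) (A : set T) (B : set I) :
  (forall i, B i -> measurable (A `&` [set x | f x = i])) ->
  mu (A `&` [set x | B (f x)]) =
  (\esum_(i in [set: I]) if `[< B i >] then mu (A `&` [set x | f x =
    i]) else 0)%E.
Proof.
move=> mA.
pose F n := if @pickle_inv I n is Some i then
  if `[< B i >] then A `&` [set x | f x = i] else set0 else set0.
have mF n : measurable (F n).
  by rewrite /F; case: pickle_inv => // i; case: asboolP => // /mA.
have -> : A `&` [set x | B (f x)] = \bigcup_n F n.
  apply/seteqP; split => [x /= [Ax Bx]|x /= [n _]].
    by exists (pickle (f x)) => //; rewrite /F pickleK_inv; case: asboolP.
  by rewrite /F; case: pickle_inv => // i; case: asboolP => // Bi [Ax /= ->].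
rewrite esum_countE; last by move=> i; case: ifP.
rewrite measure_semi_bigcup//; last 2 first.
- apply/trivIsetP => m n _ _; apply: contra_neqP => /eqP/set0P[x] /=.
  rewrite /F; case Em : (pickle_inv m) => [i|] [] //=;
    case: asboolP => //= _ [_ xi].
  case En : (pickle_inv n) => [j|] //=; case: asboolP => //= _ [_ xj].
  have := @pickle_invK I m; have := @pickle_invK I n; rewrite Em En /=.
  by move=> <- <-; rewrite -xi -xj.
- exact: bigcup_measurable.
apply: eq_eseriesr => n _; rewrite /F; case: pickle_inv => /= [i|];
  last exact: measure0.
by case: asboolP => // _; exact: measure0.
Qed.

(** * The process sampled on dyadic grids *)
Section Markov.
Variables (R : realType) (d : measure_display) (Omega : measurableType d).
Variables (S : countType) (P : S -> probability Omega R) (X : R -> Omega -> S).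
Variables (Q : S -> S -> R) (D : set S).
Hypothesis hX : markov_chain P X Q.
Implicit Types (i j k l : S) (A : set Omega) (B : set S) (s t : R).
Implicit Types (L : seq (R * set S)).

Definition pr i A : R := fine (P i A).

Lemma prE i A : measurable A -> P i A = (pr i A)%:E.
Proof. by move=> mA; rewrite /pr fineK// fin_num_measure. Qed.

Lemma pr_ge0 i A : 0 <= pr i A.
Proof. by rewrite /pr fine_ge0. Qed.

Lemma pr_le1 i A : measurable A -> pr i A <= 1.
Proof. by move=> mA; rewrite -lee_fin -prE// probability_le1. Qed.

Lemma le_pr i A A' : measurable A -> measurable A' -> A `<=` A' -> pr i A <=
  pr i A'.
Proof. by move=> mA mA' AA'; rewrite -lee_fin -!prE// le_measure// inE. Qed.

Lemma pr_setT i : pr i setT = 1.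
Proof. by rewrite /pr probability_setT. Qed.

Lemma pr_set0 i : pr i set0 = 0.
Proof. by rewrite /pr measure0. Qed.

Lemma pr_eq0 i A : (forall w, ~ A w) -> pr i A = 0.
Proof.
by move=> A0; rewrite -(pr_set0 i); congr pr; apply/seteqP; split => w // /A0.
Qed.

Lemma pr_setC i A : measurable A -> pr i (~` A) = 1 - pr i A.
Proof.
by move=> mA; apply: EFin_inj; rewrite EFinB -!prE//;
  [exact: probability_setC|exact: measurableC].
Qed.

Lemma measurable_X t B : 0 <= t -> measurable [set w | B (X t w)].
Proof.
move=> t0.
have -> : [set w | B (X t w)] =
    \bigcup_n (if @pickle_inv S n is Some j then
      if `[< B j >] then [set w | X t w = j] else set0 else set0).
  apply/seteqP; split => [w /= Bw|w /= [n _]].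
    by exists (pickle (X t w)) => //; rewrite pickleK_inv; case: asboolP.
  by case: pickle_inv => // j; case: asboolP => // Bj /= ->.
apply: bigcup_measurable => n _; case: pickle_inv => // j; case: ifP => // _.
exact: mc_measurable hX _ _ t0.
Qed.

Lemma measurable_Xeq t j : 0 <= t -> measurable [set w | X t w = j].
Proof. by move=> t0; exact: mc_measurable hX _ _ t0. Qed.

Lemma pr_has_sum i A t B : measurable A -> 0 <= t ->
  has_sum (fun j => if `[< B j >] then pr i (A `&` [set w | X t w = j]) else 0)
    (pr i (A `&` [set w | B (X t w)])).
Proof.
move=> mA t0.
have mAj j : measurable (A `&` [set w | X t w = j]).
  by apply: measurableI => //; exact: measurable_Xeq.
apply/ge0_has_sumE => [j|]; first by case: ifP => // _; exact: pr_ge0.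
rewrite -prE; last by apply: measurableI => //; exact: measurable_X.
rewrite (@measure_esum _ _ _ (P i) S (X t) A B)//.
by apply: eq_esum => j _; case: ifP => // _; rewrite -prE.
Qed.

Lemma pr_has_sumT i A t : measurable A -> 0 <= t ->
  has_sum (fun j => pr i (A `&` [set w | X t w = j])) (pr i A).
Proof.
move=> mA t0; have := @pr_has_sum i A t setT mA t0.
rewrite (_ : [set w | setT (X t w)] = setT) ?setIT; last by apply/seteqP; split.
by apply: eq_has_sum => j; case: asboolP => // /(_ Logic.I).
Qed.

Lemma pr_start i A : measurable A -> pr i (A `&` [set w | X 0 w = i]) = pr i A.
Proof.
move=> mA; have mi := @measurable_Xeq 0 i (lexx _).
have h : pr i (~` [set w | X 0 w = i]) = 0.
  by rewrite pr_setC// /pr (mc_start hX) subrr.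
apply/eqP; rewrite eq_le le_pr//=; last exact: measurableI.
have mAc : measurable (A `&` ~` [set w | X 0 w = i]).
  by apply: measurableI => //; exact: measurableC.
have mAi : measurable (A `&` [set w | X 0 w = i]) by exact: measurableI.
have : pr i A = pr i (A `&` [set w | X 0 w =
  i]) + pr i (A `&` ~` [set w | X 0 w = i]).
  by apply: EFin_inj; rewrite EFinD -!prE// addeC -setDE; exact: measureDI.
have le : pr i (A `&` ~` [set w | X 0 w = i]) <= pr i (~` [set w | X 0 w = i]).
  by apply: le_pr => //; exact: measurableC.
by move=> ->; rewrite gerDl (le_trans le)// h.
Qed.

(** * Cylinder events and the Markov property *)

Fixpoint cylinder L : set Omega :=
  if L is p :: L' then [set w | p.2 (X p.1 w)] `&` cylinder L' else setT.

Lemma measurable_cylinder L : all (fun p => 0 <= p.1) L ->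
  measurable (cylinder L).
Proof.
elim: L => [_|[u B] L IH /= /andP[u0 /IH mL]]; first exact: measurableT.
by apply: measurableI => //; exact: measurable_X.
Qed.

Lemma cylinder_cat L L' : cylinder (L ++ L') = cylinder L `&` cylinder L'.
Proof. by elim: L => [|p L IH] /=; rewrite ?setTI// IH setIA. Qed.

Definition past_event (past : seq (R * S)) : set Omega :=
  [set w | forall u, u \in past -> X u.1 w = u.2].

Lemma past_event_cons u past :
  past_event (u :: past) = [set w | X u.1 w = u.2] `&` past_event past.
Proof.
apply/seteqP; split => [w /= h|w /= [h1 h2] v].
  by split=> [|v vp]; apply: h; rewrite inE ?eqxx// vp orbT.
by rewrite inE => /predU1P[->|/h2].
Qed.

Lemma measurable_past_event (past : seq (R * S)) :
  all (fun u => 0 <= u.1) past -> measurable (past_event past).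
Proof.
elim: past => [_|u past IH /= /andP[u0 /IH mL]].
  rewrite (_ : past_event _ = setT); first exact: measurableT.
  by apply/seteqP; split.
by rewrite past_event_cons; apply: measurableI => //; exact: measurable_Xeq.
Qed.

Definition trans_prob t i j := pr i [set w | X t w = j].

Lemma trans_prob_ge0 t i j : 0 <= trans_prob t i j.
Proof. exact: pr_ge0. Qed.

(** The Markov property is given for pasts that prescribe single values, whereas avoiding [D]
    prescribes sets. Induction on [L] moves one set constraint at a time into [past], by summing
    over the value [l] taken at that time. *)
Lemma markov_cylinder i L past s t j k : 0 <= s -> 0 <= t ->
  all (fun p => 0 <= p.1 <= s) L -> all (fun u => 0 <= u.1 <= s) past ->
  pr i (cylinder L `&` past_event past `&` [set w | X s w = j]
        `&` [set w | X (s + t) w = k]) =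
  pr i (cylinder L `&` past_event past `&` [set w | X s w =
    j]) * trans_prob t j k.
Proof.
move=> s0 t0.
have st0 : 0 <= s + t by rewrite addr_ge0.
have weakL L' : all (fun p => 0 <= p.1 <= s) L' -> all (fun p => 0 <= p.1) L'.
  by apply: sub_all => p /andP[].
have weakp past' : all (fun u : R * S => 0 <= u.1 <= s) past' ->
    all (fun u => 0 <= u.1) past' by apply: sub_all => p /andP[].
elim: L past => [|[u B] L IH] past /=.
  move=> _ hp; rewrite setTI.
  have := mc_markov hX i (past := past) j k s0 t0.
  rewrite /trans_prob /pr => -> /=; last by move=> v /(allP hp).
  rewrite fineM//; apply: fin_num_measure; last exact: measurable_Xeq.
  apply: measurableI; last exact: measurable_Xeq.
  by apply: measurable_past_event; exact: weakp.
move=> /andP[us hL] hp; have u0 : 0 <= u by case/andP: us.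
set A := cylinder L `&` past_event past `&` [set w | X s w = j].
have mA : measurable A.
  apply: measurableI; last exact: measurable_Xeq.
  apply: measurableI; [apply: measurable_cylinder; exact: weakL|].
  by apply: measurable_past_event; exact: weakp.
have mAk : measurable (A `&` [set w | X (s + t) w = k]).
  by apply: measurableI => //; exact: measurable_Xeq.
have -> : [set w | B (X u w)] `&` cylinder L `&` past_event past
    `&` [set w | X s w = j] `&` [set w | X (s + t) w = k] =
    A `&` [set w | X (s + t) w = k] `&` [set w | B (X u w)].
  by apply/seteqP; split => w /=; rewrite /A /=; tauto.
have -> : [set w | B (X u w)] `&` cylinder L `&` past_event past
    `&` [set w | X s w = j] = A `&` [set w | B (X u w)].
  by apply/seteqP; split => w /=; rewrite /A /=; tauto.
apply: has_sum_unique (pr_has_sum i B mAk u0) _.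
rewrite mulrC; apply: eq_has_sum (has_sumZ (trans_prob t j k) (pr_has_sum i B mA
  u0)) => l.
case: asboolP => // Bl; last by rewrite mulr0.
have := IH ((u, l) :: past) hL; rewrite /= us hp => /(_ isT).
rewrite past_event_cons /= => h; rewrite mulrC.
transitivity (pr i (cylinder L `&` ([set w | X u w = l] `&` past_event past)
  `&` [set w | X s w = j]) * trans_prob t j k).
  by congr (pr i _ * _); apply/seteqP; split => w /=; rewrite /A /=; tauto.
rewrite -h; congr (pr i _).
by apply/seteqP; split => w /=; rewrite /A /=; tauto.
Qed.

(** [m] steps, hence [m + 1] times with both ends included. The latest time comes first, so that one
    more step is one more [cons]. *)
Fixpoint grid s dt m : seq (R * set S) :=
  match m with
  | 0%N => [:: (s, ~` D)]
  | n.+1 => (s + n.+1%:R * dt, ~` D) :: grid s dt n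
  end.

Lemma cylinder_gridP s dt m w : cylinder (grid s dt m) w <->
  forall r, (r <= m)%N -> ~ D (X (s + r%:R * dt) w).
Proof.
elim: m => [|m IH].
  split=> [[/= h _] r|h]; first by rewrite leqn0 => /eqP ->;
    rewrite mul0r addr0.
  by split => //=; have := h 0%N isT; rewrite mul0r addr0.
split=> [[/= h1 /IH h2] r|h].
  by rewrite leq_eqVlt => /predU1P[->//|]; rewrite ltnS => /h2.
split=> /=; first exact: h.
by apply/IH => r rm; apply: h; rewrite leqW.
Qed.

Lemma grid_times s dt m u : 0 <= s -> 0 <= dt -> s + m%:R * dt <= u ->
  all (fun p => 0 <= p.1 <= u) (grid s dt m).
Proof.
move=> s0 dt0; elim: m => [|m IH] /= h.
  by rewrite s0/= andbT; move: h; rewrite mul0r addr0.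
rewrite h andbT addr_ge0 ?mulr_ge0//=; apply: IH; apply: le_trans h.
by rewrite lerD2l ler_wpM2r// ler_nat.
Qed.

(** The cylinder stops at step [m], so the value [k] at step [m + 1] may lie in [D]. This is the
    one-step recursion on which the grid arguments rest. *)
Lemma grid_step i L s dt m k : 0 <= s -> 0 <= dt ->
  all (fun p => 0 <= p.1 <= s) L ->
  has_sum (fun l => pr i (cylinder (grid s dt m ++ L)
                          `&` [set w | X (s + m%:R * dt) w =
                            l]) * trans_prob dt l k)
    (pr i (cylinder (grid s dt m ++ L) `&` [set w | X (s + m.+1%:R * dt) w =
      k])).
Proof.
move=> s0 dt0 hL.
have m0 : 0 <= m%:R * dt by rewrite mulr_ge0.
have sm0 : 0 <= s + m%:R * dt by rewrite addr_ge0.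
have sm : s <= s + m%:R * dt by rewrite lerDl.
have hG : all (fun p => 0 <= p.1 <= s + m%:R * dt) (grid s dt m ++ L).
  rewrite all_cat grid_times//=; apply: sub_all hL => p /andP[-> /le_trans];
    exact.
have mG : measurable (cylinder (grid s dt m ++ L)).
  by apply: measurable_cylinder; apply: sub_all hG => p /andP[].
have -> : s + m.+1%:R * dt = s + m%:R * dt + dt
  by rewrite -addn1 natrD mulrDl mul1r addrA.
have mGk : measurable (cylinder (grid s dt m ++ L)
    `&` [set w | X (s + m%:R * dt + dt) w = k]).
  by apply: measurableI => //; apply: measurable_Xeq; rewrite addr_ge0.
apply: eq_has_sum (pr_has_sumT i mGk sm0) => l.
have := @markov_cylinder i (grid s dt m ++ L) [::] _ dt l k sm0 dt0 hG isT.
rewrite (_ : past_event [::] = setT); last by apply/seteqP; split.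
by rewrite setIT => <-; congr (pr i _); apply/seteqP; split => w /=; tauto.
Qed.

(** For [k] outside [D], both sides satisfy the recursion [grid_step] in [m]; for [k] in [D], both
    vanish. Only [m = 0] needs a separate look, because time [s] then carries the constraint of the
    grid and both values [j] and [k]. *)
Lemma grid_markov i L s dt m j k : 0 <= s -> 0 <= dt ->
  all (fun p => 0 <= p.1 <= s) L ->
  pr i (cylinder (grid s dt m ++ (s, [set j]) :: L)
        `&` [set w | X (s + m%:R * dt) w = k]) =
  pr i (cylinder ((s, [set j]) :: L)) *
  pr j (cylinder (grid 0 dt m) `&` [set w | X (0 + m%:R * dt) w = k]).
Proof.
move=> s0 dt0 hL; set L' := _ :: L.
have hL' : all (fun p => 0 <= p.1 <= s) L' by rewrite /= s0 lexx.
have mL' : measurable (cylinder L').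
  by apply: measurable_cylinder; apply: sub_all hL' => p /andP[].
elim: m k => [|m IH] k.
  rewrite !mul0r !addr0 /= setIT.
  have [<-{k}|jk] := eqVneq j k; last first.
    rewrite [LHS]pr_eq0; last first.
      by move=> w /= [[_ [Xj _]] Xk]; move/eqP: jk; rewrite -Xj -Xk.
    rewrite -(pr_start j); last first.
      by apply: measurableI; [exact: (@measurable_X 0 (~` D))|exact:
        measurable_Xeq].
    rewrite [X in _ * X]pr_eq0 ?mulr0// => w /= [[_ Xk] Xj].
    by move/eqP: jk; rewrite -Xj -Xk.
  have [Dj|nDj] := pselect (D j).
    rewrite [LHS]pr_eq0; last by move=> w /= [[nD _] Xk]; apply: nD; rewrite Xk.
    rewrite [X in _ * X]pr_eq0 ?mulr0// => w /= [nD Xk].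
    by apply: nD; rewrite Xk.
  rewrite -[LHS]mulr1 -(pr_setT j) -(pr_start j measurableT) setTI.
  congr (pr i _ * pr j _); apply/seteqP; split => w /=; rewrite /L' /=.
  - tauto.
  - by move=> [-> cL]; do !split.
  - by move=> ->; split.
  - tauto.
have [Dk|nDk] := pselect (D k).
  rewrite [LHS]pr_eq0; last by move=> w /= [[nD _] Xk]; apply: nD; rewrite Xk.
  rewrite [X in _ * X]pr_eq0 ?mulr0// => w /= [[nD _] Xk].
  by apply: nD; rewrite Xk.
(* For [k] outside [D], the last constraint follows from being at [k]; without it the event has the
   form required by [grid_step]. *)
have dropD M (u : R) : cylinder (((u, ~` D) : R *
  set S) :: M) `&` [set w | X u w = k] =
    cylinder M `&` [set w | X u w = k].
  by apply/seteqP; split => w /= => [[[? ?] ?] //|[? E]]; rewrite E.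
rewrite /= [X in pr i X](dropD (grid s dt m ++ L')) [X in pr j X](dropD (grid 0
  dt m)).
have h1 := @grid_step i L' s dt m k s0 dt0 hL'.
have h2 := @grid_step j [::] 0 dt m k (lexx _) dt0 isT.
rewrite !cats0 in h2.
apply: has_sum_unique h1 _.
apply: eq_has_sum (has_sumZ (pr i (cylinder L')) h2) => l.
by rewrite IH mulrA.
Qed.

(** * From dyadic grids to whole time intervals *)

Definition avoid s t : set Omega := [set w | forall u, s <= u <= s + t ->
  ~ D (X u w)].

Lemma pow2_gt0 n : (0 : R) < (2 ^ n)%:R.
Proof. by rewrite ltr0n expn_gt0. Qed.

(* Paths are constant on some [[u, u + e[], which contains a grid point as soon
   as the mesh is smaller than [e]. *)
Lemma avoid_grid s t : 0 <= s -> 0 <= t ->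
  avoid s t = \bigcap_n cylinder (grid s (t / (2 ^ n)%:R) (2 ^ n)).
Proof.
move=> s0 t0; apply/seteqP; split => w.
  move=> h n _; apply/cylinder_gridP => r rn; apply: h.
  have p0 := pow2_gt0 n.
  rewrite lerDl mulr_ge0 ?divr_ge0//= ?(ltW p0)// lerD2l mulrCA ler_piMr//.
  by rewrite ler_pdivrMr// mul1r ler_nat.
move=> h u /andP[su ust].
have h' n r : (r <= 2 ^ n)%N -> ~ D (X (s + r%:R * (t / (2 ^ n)%:R)) w).
  by move: r; apply/cylinder_gridP; exact: h.
move: ust; rewrite le_eqVlt => /predU1P[->|ust].
  by have := h' 0%N 1%N (leqnn _); rewrite expn0 divr1 mul1r.
have u0 : 0 <= u by exact: le_trans su.
have [e e0 ue] := mc_paths hX w u0.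
have t_gt0 : 0 < t.
  by rewrite -(ltrD2l s) addr0; exact: le_lt_trans ust.
(* The second bound keeps the grid point found after [u] inside [[s, s + t]]. *)
pose e' := Num.min e (s + t - u).
have e'0 : 0 < e' by rewrite lt_min e0 subr_gt0.
have [n tn] : exists n, t / (2 ^ n)%:R < e'.
  have [n] := ltr_add_invr (y := 0) (x := e' / t) (divr_gt0 e'0 t_gt0).
  rewrite add0r => hn; exists n.+1.
  rewrite mulrC -ltr_pdivlMr//; apply: le_lt_trans hn.
  rewrite lef_pV2 ?posrE ?pow2_gt0 ?ltr0n// ler_nat; exact/ltnW/ltn_expl.
have p0 := pow2_gt0 n.
pose dt := t / (2 ^ n)%:R.
have dt0 : 0 < dt by rewrite divr_gt0.
pose r := (Num.truncn ((u - s) / dt)).+1.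
have us0 : 0 <= (u - s) / dt by rewrite divr_ge0 ?subr_ge0// ltW.
have /andP[r1 r2] := truncn_itv us0.
have r1' : s + r%:R * dt <= u + dt.
  move: r1; rewrite ler_pdivlMr// => r1.
  by rewrite /r -addn1 natrD mulrDl mul1r addrA lerD2r addrC -lerBrDr.
have r2' : u <= s + r%:R * dt.
  by move: r2; rewrite ltr_pdivrMr// => /ltW; rewrite lerBlDl.
have rn : (r <= 2 ^ n)%N.
  have : r%:R * dt <= t.
    have : e' <= s + t - u by rewrite ge_min lexx orbT.
    by move: r1' tn; rewrite -/dt; lra.
  by rewrite /dt mulrCA ger_pMr// ler_pdivrMr// mul1r ler_nat.
rewrite -(ue (s + r%:R * dt)); first exact: h'.
rewrite r2'/=; apply: le_lt_trans r1' _; rewrite ltrD2l;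
  apply: lt_le_trans tn _.
by rewrite ge_min lexx.
Qed.

(** Point [r] of one dyadic grid is point [2 r] of the next; the refinement makes continuity from
    above applicable. *)
Lemma grid_nonincreasing s t : nonincreasing_seq
  (fun n => cylinder (grid s (t / (2 ^ n)%:R) (2 ^ n))).
Proof.
apply/nonincreasing_seqP => n; apply/subsetPset => w /cylinder_gridP h.
apply/cylinder_gridP => r rn.
have := h (r * 2)%N; rewrite expnSr leq_mul2r rn orbT => /(_ isT).
rewrite !natrM invfM.
suff -> : r%:R * 2 * (t * ((2 ^ n)%:R^-1 / 2)) = r%:R * (t / (2 ^ n)%:R) by [].
by field; rewrite pnatr_eq0 expn_eq0.
Qed.

(** A path outside [D] at time [t] stays at the same state on some [[t, t + e[], so its passage time
    is at least [t + e]. This gives the strict inequality [t < T] although [T] is only an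
    infimum. *)
Lemma survivalE t : 0 <= t -> survival X D t = avoid 0 t.
Proof.
move=> t0; apply/seteqP; split => w.
  rewrite /survival /passage_time /= => h u /andP[u0]; rewrite add0r => ut Du.
  move: h; apply/negP; rewrite -leNgt; apply: le_trans (_ : u%:E <= _)%E;
    last first.
    by rewrite lee_fin.
  by apply: ereal_inf_lbound; exists u.
move=> h; rewrite /survival /passage_time /=.
have [e e0 ue] := mc_paths hX w t0.
apply: (@lt_le_trans _ _ (t + e)%:E); first by rewrite lte_fin ltrDl.
apply: le_ereal_inf_tmp => _ [u [u0 Du] <-]; rewrite lee_fin leNgt;
  apply/negP => ute.
have [ut|tu] := leP u t; first by apply: (h u) => //; rewrite u0 add0r.
apply: (h t); first by rewrite t0 add0r lexx.
by rewrite -(ue u)// (ltW tu).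
Qed.

Lemma avoidD s t : 0 <= s -> 0 <= t -> avoid 0 (s + t) =
  avoid 0 s `&` avoid s t.
Proof.
move=> s0 t0; apply/seteqP; split => w.
  by move=> h; split => u /andP[u1 u2]; apply: h; rewrite ?add0r in u2 *; lra.
move=> [h1 h2] u /andP[u0 ust]; have [us|su] := leP u s.
  by apply: h1; rewrite u0 add0r.
by apply: h2; move: ust; rewrite (ltW su) add0r.
Qed.

Lemma measurable_grid s t n : 0 <= s -> 0 <= t ->
  measurable (cylinder (grid s (t / (2 ^ n)%:R) (2 ^ n))).
Proof.
move=> s0 t0; apply: measurable_cylinder.
have := @grid_times s (t / (2 ^ n)%:R) (2 ^ n) _ s0 _ (lexx _).
rewrite divr_ge0 ?(ltW (pow2_gt0 n))// => /(_ isT).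
by apply: sub_all => p /andP[].
Qed.

Lemma measurable_avoid s t : 0 <= s -> 0 <= t -> measurable (avoid s t).
Proof.
move=> s0 t0; rewrite avoid_grid//; apply: bigcapT_measurable => n.
exact: measurable_grid.
Qed.

Lemma pr_bigcap_cvg i (F : nat -> set Omega) : (forall n, measurable (F n)) ->
  nonincreasing_seq F -> (fun n => pr i (F n)) @ \oo --> pr i (\bigcap_n F n).
Proof.
move=> mF nF.
have mI : measurable (\bigcap_n F n) by exact: bigcapT_measurable.
have := @nonincreasing_cvg_mu _ _ _ (P i) F _ mF mI nF.
rewrite ltey_eq fin_num_measure// => /(_ isT) h.
by apply: fine_cvg; rewrite -prE.
Qed.

(** The Markov property of the killed process, as the limit of [grid_markov]. [F n], [G n] and [H n]
    are the grid events on [[0, s]], [[s, s + t]] and [[0, t]]; the third is the second restarted at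
    time 0. *)
Lemma avoid_markov i s t j k : 0 <= s -> 0 <= t ->
  pr i (avoid 0 (s + t) `&` [set w | X s w = j] `&` [set w | X (s + t) w = k]) =
  pr i (avoid 0 s `&` [set w | X s w = j]) *
    pr j (avoid 0 t `&` [set w | X t w = k]).
Proof.
move=> s0 t0.
have st0 : 0 <= s + t by rewrite addr_ge0.
have mj : measurable [set w | X s w = j] by exact: measurable_Xeq.
have mk : measurable [set w | X (s + t) w = k] by exact: measurable_Xeq.
have mk' : measurable [set w | X t w = k] by exact: measurable_Xeq.
pose F n := cylinder (grid 0 (s / (2 ^ n)%:R) (2 ^ n)).
pose G n := cylinder (grid s (t / (2 ^ n)%:R) (2 ^ n)).
pose H n := cylinder (grid 0 (t / (2 ^ n)%:R) (2 ^ n)).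
have mF n : measurable (F n) by exact: measurable_grid.
have mG n : measurable (G n) by exact: measurable_grid.
have mH n : measurable (H n) by exact: measurable_grid.
have c1 : (fun n => pr i (F n `&` [set w | X s w =
  j] `&` G n `&` [set w | X (s + t) w = k]))
    @ \oo --> pr i (avoid 0 (s + t) `&` [set w | X s w =
      j] `&` [set w | X (s + t) w = k]).
  rewrite [X in pr i X](_ : _ = \bigcap_n (F n `&` [set w | X s w = j] `&` G n
      `&` [set w | X (s + t) w = k])); last first.
    rewrite avoidD// (avoid_grid (lexx _) s0) (avoid_grid s0 t0).
    apply/seteqP; split => w /=.
      by move=> [[[h1 h2] h3] h4] n _; split => //; split; [split|] => //;
        [exact: h1|exact: h2].
    move=> h; split; last by have [] := h 0%N Logic.I.
    split; last by have [[[]]] := h 0%N Logic.I.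
    by split => n _; have [[[]]] := h n Logic.I.
  apply: pr_bigcap_cvg => [n|]; first by do 3 apply: measurableI => //.
  move=> m n mn; apply/subsetPset => w /= [[[h1 h2] h3] h4].
  have FF : F n `<=` F m by apply/subsetPset; exact: grid_nonincreasing.
  have GG : G n `<=` G m by apply/subsetPset; exact: grid_nonincreasing.
  by split => //; split; [split|] => //; [exact: FF|exact: GG].
have c2 : (fun n => pr i (F n `&` [set w | X s w = j])) @ \oo -->
    pr i (avoid 0 s `&` [set w | X s w = j]).
  rewrite [X in pr i X](_ : _ = \bigcap_n (F n `&` [set w | X s w = j]));
    last first.
    rewrite (avoid_grid (lexx _) s0); apply/seteqP; split => w /=.
      by move=> [h1 h2] n _; split => //; exact: h1.
    by move=> h; split => [n _|]; [have [] := h n Logic.I|have [] :=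
      h 0%N Logic.I].
  apply: pr_bigcap_cvg => [n|]; first exact: measurableI.
  move=> m n mn; apply/subsetPset => w /= [h1 h2]; split => //.
  by move: w h1 {h2}; apply/subsetPset; exact: grid_nonincreasing.
have c3 : (fun n => pr j (H n `&` [set w | X t w = k])) @ \oo -->
    pr j (avoid 0 t `&` [set w | X t w = k]).
  rewrite [X in pr j X](_ : _ = \bigcap_n (H n `&` [set w | X t w = k]));
    last first.
    rewrite (avoid_grid (lexx _) t0); apply/seteqP; split => w /=.
      by move=> [h1 h2] n _; split => //; exact: h1.
    by move=> h; split => [n _|]; [have [] := h n Logic.I|have [] :=
      h 0%N Logic.I].
  apply: pr_bigcap_cvg => [n|]; first exact: measurableI.
  move=> m n mn; apply/subsetPset => w /= [h1 h2]; split => //.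
  by move: w h1 {h2}; apply/subsetPset; exact: grid_nonincreasing.
apply: (cvg_unique _ c1) => //=.
rewrite (_ : (fun n => _) = (fun n => pr i (F n `&` [set w | X s w = j]) *
    pr j (H n `&` [set w | X t w = k]))); first exact: cvgM.
apply/funext => n.
have p0 := pow2_gt0 n.
have tE u : u + (2 ^ n)%:R * (t / (2 ^ n)%:R) = u + t.
  by rewrite mulrCA divff ?mulr1// gt_eqF.
have sE : 0 + (2 ^ n)%:R * (s / (2 ^ n)%:R) = s.
  by rewrite add0r mulrCA divff ?mulr1// gt_eqF.
have := @grid_markov i (grid 0 (s / (2 ^ n)%:R) (2 ^ n)) s (t / (2 ^ n)%:R) (2 ^
  n) j k s0.
rewrite divr_ge0 ?(ltW p0)// grid_times ?sE ?divr_ge0 ?(ltW p0)// =>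
  /(_ isT isT).
rewrite !tE add0r cylinder_cat /= => h.
transitivity (pr i ([set w | X s w = j] `&` F n) *
  pr j (H n `&` [set w | X t w = k])).
  by rewrite -h; congr (pr i _); apply/seteqP; split => w /=; rewrite /F /G;
    tauto.
by rewrite setIC.
Qed.

End Markov.

(** * The killed transition probabilities and their backward equation *)
Section Killed.
Variables (R : realType) (d : measure_display) (Omega : measurableType d).
Variables (S : countType) (P : S -> probability Omega R) (X : R -> Omega -> S).
Variables (Q : S -> S -> R) (D : set S).
Hypothesis hX : markov_chain P X Q.
Implicit Types (i j k l : S) (A : set Omega) (B : set S) (s t h : R).

Local Notation trans_prob := (trans_prob P X).

(** With [B] a singleton this is a killed transition probability, with [B = setT] the survival
    probability, so both are treated at once. The starting point ranges over all of [S]; the value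
    is 0 on [D], so sums may run over [S]. *)
Definition killed_prob B t i : R := pr P i (avoid X D 0 t `&` [set w | B (X t
  w)]).

Lemma killed_prob_measurable B t : 0 <= t ->
  measurable (avoid X D 0 t `&` [set w | B (X t w)]).
Proof.
move=> t0; apply: measurableI; first exact: (measurable_avoid D hX).
exact: (measurable_X hX).
Qed.

Lemma killed_prob_ge0 B t i : 0 <= killed_prob B t i.
Proof. exact: pr_ge0. Qed.

Lemma killed_prob_le1 B t i : 0 <= t -> killed_prob B t i <= 1.
Proof. by move=> t0; apply: pr_le1; exact: killed_prob_measurable. Qed.

Lemma killed_prob_has_sum B t i : 0 <= t ->
  has_sum (fun k => if `[< B k >] then killed_prob [set k] t i else 0)
    (killed_prob B t i).
Proof.
by move=> t0; apply: (pr_has_sum hX) => //; exact: (measurable_avoid D hX).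
Qed.

Lemma killed_prob_has_sumT t i : 0 <= t -> has_sum (fun k =>
  killed_prob [set k] t i) (killed_prob setT t i).
Proof.
move=> t0; apply: eq_has_sum (killed_prob_has_sum setT i t0) => k.
by case: asboolP => // /(_ Logic.I).
Qed.

(** Chapman-Kolmogorov: the event is split first by the state at time [s], then by the state in [B]
    at time [s + t], to reach the pointwise form of [avoid_markov]. *)
Lemma killed_prob_CK B s t i : 0 <= s -> 0 <= t ->
  has_sum (fun j => killed_prob [set j] s i *
    killed_prob B t j) (killed_prob B (s + t) i).
Proof.
move=> s0 t0; have st0 : 0 <= s + t by rewrite addr_ge0.
apply: eq_has_sum (pr_has_sumT hX i (killed_prob_measurable B st0) s0) => j.
have mA : measurable (avoid X D 0 (s + t) `&` [set w | X s w = j]).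
  by apply: measurableI; [exact: (measurable_avoid D hX)|exact: (measurable_Xeq
    hX)].
rewrite (_ : _ `&` _ `&` _ = avoid X D 0 (s + t) `&` [set w | X s w = j]
    `&` [set w | B (X (s + t) w)]); last first.
  by apply/seteqP; split => w /=; tauto.
apply: has_sum_unique (pr_has_sum hX i B mA st0) _.
apply: eq_has_sum (has_sumZ (killed_prob [set j] s i) (killed_prob_has_sum B j
  t0)) => k.
by case: asboolP => // _; rewrite ?mulr0// (avoid_markov D hX).
Qed.

Lemma killed_prob_D B t i : 0 <= t -> D i -> killed_prob B t i = 0.
Proof.
move=> t0 Di; rewrite /killed_prob -(pr_start hX);
  last exact: killed_prob_measurable.
apply: pr_eq0 => w /= [[h _] Xi]; apply: (h 0); last by rewrite Xi.
by rewrite lexx add0r.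
Qed.

Lemma killed_prob_Dr t i k : 0 <= t -> D k -> killed_prob [set k] t i = 0.
Proof.
move=> t0 Dk; apply: pr_eq0 => w /= [h Xk]; apply: (h t); last by rewrite Xk.
by rewrite t0 add0r lexx.
Qed.

Lemma killed_prob_le_trans t i k : 0 <= t -> killed_prob [set k] t i <=
  trans_prob t i k.
Proof.
move=> t0; apply: le_pr => //; [exact: killed_prob_measurable|exact:
  (measurable_Xeq hX)].
Qed.

Lemma trans_prob_has_sum t i : 0 <= t -> has_sum (trans_prob t i) 1.
Proof.
move=> t0; rewrite -(pr_setT P i).
by apply: eq_has_sum (pr_has_sumT hX i measurableT t0) => j; rewrite setTI.
Qed.

Lemma trans_prob_le1 t i j : 0 <= t -> trans_prob t i j <= 1.
Proof. by move=> t0; apply: pr_le1; exact: (measurable_Xeq hX). Qed.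

(** * Lower bounds for the chain sampled on a grid *)

Section Grid.
Variables (dt : R) (i : S).
Hypothesis dt0 : 0 <= dt.

Let g m j := pr P i (cylinder X (grid D 0 dt m) `&` [set w | X (0 + m%:R *
  dt) w = j]).

Let g0 : ~ D i -> g 0 i = 1.
Proof.
move=> nDi; rewrite /g mul0r addr0 /= setIT -(pr_setT P i) -(pr_start hX i
  measurableT) setTI.
by congr (pr _ _ _); apply/seteqP; split => w /= => [[]//|->].
Qed.

Let gS m j : ~ D j -> has_sum (fun l => g m l * trans_prob dt l j) (g m.+1 j).
Proof.
move=> nDj.
have := @grid_step _ _ _ _ P X Q D hX i [::] 0 dt m j (lexx _) dt0 isT.
rewrite !cats0; congr (has_sum _ _); rewrite /g; congr (pr _ _ _).
by apply/seteqP; split => w /= => [[? E]|[[]//]]; rewrite E.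
Qed.

Lemma grid_stay_ge m : ~ D i -> trans_prob dt i i ^+ m <= g m i.
Proof.
move=> nDi; elim: m => [|m IH]; first by rewrite g0.
have := @has_sum_le_seq _ _ _ _ [:: i] _ (gS m nDi) isT.
rewrite big_seq1 => /(_ _) h; apply: le_trans (h _).
  by rewrite exprSr ler_wpM2r// trans_prob_ge0.
by move=> l; rewrite mulr_ge0// pr_ge0.
Qed.

(* Only the paths that wait in [i], jump straight to [j] at one of the [m] steps
   and wait in [j] are counted. *)
Lemma grid_jump_ge m j : ~ D i -> ~ D j -> i != j ->
  m%:R * trans_prob dt i j * (trans_prob dt i i ^+ m *
    trans_prob dt j j ^+ m) <= g m j.
Proof.
move=> nDi nDj ij; elim: m => [|m IH]; first by rewrite !mul0r pr_ge0.
have := @has_sum_le_seq _ _ _ _ [:: i; j] _ (gS m nDj).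
rewrite /= inE ij => /(_ _ isT) h; apply: le_trans (h _); last first.
  by move=> l; rewrite mulr_ge0// pr_ge0.
rewrite big_cons big_seq1.
have := grid_stay_ge m nDi.
have := trans_prob_ge0 P X dt i j; have := trans_prob_ge0 P X dt i i;
  have := trans_prob_ge0 P X dt j j.
have := trans_prob_le1 i i dt0; have := trans_prob_le1 j j dt0; move: IH.
set a := trans_prob dt i i; set b := trans_prob dt j j;
  set c := trans_prob dt i j.
move=> IH b1 a1 b0 a0 c0 st.
have am0 : 0 <= a ^+ m by rewrite exprn_ge0.
have bm0 : 0 <= b ^+ m by rewrite exprn_ge0.
have bm1 : b ^+ m * b <= 1 by rewrite -exprSr exprn_ile1.
have h1 : c * (a ^+ m * a * (b ^+ m * b)) <= g m i * c.
  rewrite [leRHS]mulrC ler_wpM2l//; apply: le_trans st.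
  rewrite -mulrA ler_piMr// -[1]mulr1 ler_pM// mulr_ge0//.
have h2 : m%:R * c * (a ^+ m * a * (b ^+ m * b)) <= g m j * b.
  apply: le_trans (_ : m%:R * c * (a ^+ m * b ^+ m) * b <= _);
    last by rewrite ler_wpM2r.
  rewrite -!mulrA !ler_wpM2l//; rewrite ler_piMl//.
  by rewrite mulr_ge0.
by rewrite -addn1 natrD mulrDl mul1r mulrDl !exprD !expr1; lra.
Qed.

End Grid.

(** * Transition rates along sequences, and the signs of the [q]-matrix *)

Section Rates.
Variable h : nat -> R.
Hypothesis h_gt0 : forall n, 0 < h n.
Hypothesis h_cvg0 : h @ \oo --> 0.

Lemma trans_prob_rate_neq i j : i != j -> (fun n =>
  trans_prob (h n) i j / h n) @ \oo --> Q i j.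
Proof.
move=> ij; have := iffLR (cvg_at_rightP _ _ _) (mc_qmatrix hX (i:=i) (j:=j)) h
  (conj h_gt0 h_cvg0).
by rewrite (negbTE ij) /=; under eq_fun do rewrite subr0.
Qed.

Lemma trans_prob_rate_eq i : (fun n => (trans_prob (h n) i i - 1) / h n) @ \oo
  --> Q i i.
Proof.
have := iffLR (cvg_at_rightP _ _ _) (mc_qmatrix hX (i:=i) (j:=i)) h (conj h_gt0
  h_cvg0).
by rewrite eqxx.
Qed.

End Rates.

Lemma q_ge0 i j : i != j -> 0 <= Q i j.
Proof.
move=> ij; have h := @trans_prob_rate_neq (@harmonic R) (@harmonic_gt0 R)
  (@cvg_harmonic R) i j ij.
apply: (cvgr_to_ge h); apply: nearW => n.
by rewrite divr_ge0 ?trans_prob_ge0// ltW// harmonic_gt0.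
Qed.

Lemma q_le0 i : Q i i <= 0.
Proof.
have h := @trans_prob_rate_eq (@harmonic R) (@harmonic_gt0 R) (@cvg_harmonic R)
  i.
apply: (cvgr_to_le h); apply: nearW => n.
have n0 := @harmonic_gt0 R n.
by rewrite ler_pdivrMr// mul0r subr_le0 trans_prob_le1// ltW.
Qed.

Lemma q_has_sum i : has_sum (Q i) 0.
Proof. exact: mc_conservative hX i. Qed.

Lemma q_off_has_sum i : has_sum (fun j =>
  if j == i then 0 else Q i j) (- Q i i).
Proof. by rewrite -sub0r; apply: has_sum_remove; exact: q_has_sum. Qed.

(** * Lower bounds for the killed transition probabilities *)

Section LowerBounds.
Variable h : R.
Hypothesis h0 : 0 < h.

Let dt n := h / (2 ^ n)%:R.

Let dt_gt0 n : 0 < dt n.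
Proof. by rewrite divr_gt0// pow2_gt0. Qed.

Let dt_cvg : dt @ \oo --> 0.
Proof.
rewrite -[0](mulr0 h); apply: cvgM; first exact: cvg_cst.
rewrite (_ : (fun _ => _) = (fun n => 2^-1 ^+ n)).
  by apply: cvg_expr; rewrite ger0_norm ?invr_ge0// invf_lt1// ltr1n.
by apply/funext => n; rewrite natrX exprVn.
Qed.

Let dtE n : 0 + (2 ^ n)%:R * dt n = h.
Proof. by rewrite add0r mulrCA divff ?mulr1// gt_eqF// pow2_gt0. Qed.

Let grid_cvg i j :
  (fun n => pr P i (cylinder X (grid D 0 (dt n) (2 ^ n))
                    `&` [set w | X (0 + (2 ^ n)%:R * dt n) w = j])) @ \oo -->
  killed_prob [set j] h i.
Proof.
under eq_fun do rewrite dtE.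
have mG n : measurable (cylinder X (grid D 0 (dt n) (2 ^ n))).
  by apply: (measurable_grid D hX) => //; exact: ltW.
rewrite /killed_prob (_ : _ `&` _ = \bigcap_n (cylinder X (grid D 0 (dt n) (2 ^
  n))
    `&` [set w | X h w = j])); last first.
  rewrite (avoid_grid D hX (lexx _) (ltW h0)); apply/seteqP; split => w /=.
    by move=> [h1 h2] n _; split => //; exact: h1.
  by move=> h'; split => [n _|]; [have [] := h' n Logic.I|have [] :=
    h' 0%N Logic.I].
apply: pr_bigcap_cvg => [n|].
  by apply: measurableI => //; apply: (measurable_Xeq hX); exact: ltW.
move=> m n mn; apply/subsetPset => w /= [h1 h2]; split => //.
by move: w h1 {h2}; apply/subsetPset; exact: grid_nonincreasing.
Qed.

Let exit_cvg i : (fun n => (2 ^ n)%:R * (trans_prob (dt n) i i - 1)) @ \oo -->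
  h * Q i i.
Proof.
rewrite (_ : (fun _ => _) = (fun n => h * ((trans_prob (dt n) i i - 1) / dt
  n))).
  by apply: cvgM; [exact: cvg_cst|exact: trans_prob_rate_eq].
apply/funext => n; rewrite /dt.
by field; rewrite !gt_eqF ?pow2_gt0.
Qed.

(** It replaces the probability of waiting through [2 ^ n] steps by an affine expression whose limit
    [1 + h * Q i i] is read off from the rate at 0. First order in [h] is all that the derivatives
    need. *)
Let bernoulli (x : R) m : 0 <= x -> x <= 1 -> 1 + m%:R * (x - 1) <= x ^+ m.
Proof.
move=> x0 x1; elim: m => [|m IH]; first by rewrite expr0 mul0r addr0.
have xm1 : x ^+ m <= 1 by rewrite exprn_ile1.
have : 0 <= (1 - x) * (1 - x ^+ m) by rewrite mulr_ge0// subr_ge0.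
by rewrite exprS -addn1 natrD; lra.
Qed.

Lemma killed_prob_stay_ge i : ~ D i -> 1 + h * Q i i <= killed_prob [set i] h i.
Proof.
move=> nDi.
have c : (fun n => 1 + (2 ^ n)%:R * (trans_prob (dt n) i i - 1)) @ \oo -->
  1 + h * Q i i.
  by apply: cvgD; [exact: cvg_cst|exact: exit_cvg].
apply: (ler_cvg_to c (@grid_cvg i i)); apply: nearW => n /=.
have dt0 := ltW (dt_gt0 n).
apply: le_trans (grid_stay_ge dt0 (2 ^ n) nDi).
by apply: bernoulli; [exact: trans_prob_ge0|exact: trans_prob_le1].
Qed.

Lemma killed_prob_jump_ge i j : ~ D i -> ~ D j -> i != j ->
  h * Q i j * (1 + h * Q i i + h * Q j j) <= killed_prob [set j] h i.
Proof.
move=> nDi nDj ij.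
have c : (fun n => (2 ^ n)%:R * trans_prob (dt n) i j *
    (1 + (2 ^ n)%:R * (trans_prob (dt n) i i - 1) + (2 ^ n)%:R *
      (trans_prob (dt n) j j - 1)))
    @ \oo --> h * Q i j * (1 + h * Q i i + h * Q j j).
  apply: cvgM; last first.
    by apply: cvgD; [apply: cvgD; [exact: cvg_cst|exact: exit_cvg]|exact:
      exit_cvg].
  rewrite (_ : (fun _ => _) = (fun n => h * (trans_prob (dt n) i j / dt n))).
    by apply: cvgM; [exact: cvg_cst|exact: trans_prob_rate_neq].
  apply/funext => n; rewrite /dt.
  by field; rewrite !gt_eqF ?pow2_gt0.
apply: (ler_cvg_to c (@grid_cvg i j)); apply: nearW => n /=.
have dt0 := ltW (dt_gt0 n).
apply: le_trans (grid_jump_ge dt0 (2 ^ n) nDi nDj ij).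
rewrite ler_wpM2l ?mulr_ge0 ?trans_prob_ge0//.
have bi := @bernoulli (trans_prob (dt n) i i) (2 ^ n) (trans_prob_ge0 _ _ _ _ _)
  (trans_prob_le1 i i dt0).
have bj := @bernoulli (trans_prob (dt n) j j) (2 ^ n) (trans_prob_ge0 _ _ _ _ _)
  (trans_prob_le1 j j dt0).
have i1 : trans_prob (dt n) i i ^+ (2 ^ n) <= 1
  by rewrite exprn_ile1 ?trans_prob_ge0 ?trans_prob_le1.
have j1 : trans_prob (dt n) j j ^+ (2 ^ n) <= 1
  by rewrite exprn_ile1 ?trans_prob_ge0 ?trans_prob_le1.
(* Hence the product of the two waiting probabilities is at least their sum minus 1, and Bernoulli's
   inequality applies to each. *)
have : 0 <= (1 - trans_prob (dt n) i i ^+ (2 ^ n)) *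
  (1 - trans_prob (dt n) j j ^+ (2 ^ n)).
  by rewrite mulr_ge0// subr_ge0.
lra.
Qed.

End LowerBounds.

Section KilledRates.
Variable h : nat -> R.
Hypothesis h_gt0 : forall n, 0 < h n.
Hypothesis h_cvg0 : h @ \oo --> 0.

(** Killing does not alter the rates inside [E]: the unkilled probability from above and the direct
    jump from below have the same slope at 0. *)
Lemma killed_prob_rate_neq i j : ~ D i -> ~ D j -> i != j ->
  (fun n => killed_prob [set j] (h n) i / h n) @ \oo --> Q i j.
Proof.
move=> nDi nDj ij.
apply: (squeeze_cvgr (f := fun n => Q i j * (1 + h n * Q i i + h n * Q j j))
  (h := fun n => trans_prob (h n) i j / h n)); last exact: trans_prob_rate_neq.
  apply: nearW => n; rewrite ler_pdivlMr// mulrAC [Q i j *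
    _]mulrC killed_prob_jump_ge//=.
  by rewrite ler_wpM2r ?invr_ge0 ?(ltW (h_gt0 n))// killed_prob_le_trans// ltW.
rewrite -[X in _ --> X](_ : Q i j * (1 + 0 * Q i i + 0 * Q j j) = _);
  last by ring.
apply: cvgM; first exact: cvg_cst.
by apply: cvgD; [apply: cvgD; [exact: cvg_cst|]|]; apply: cvgM => //;
  exact: cvg_cst.
Qed.

Lemma killed_prob_rate_eq i : ~ D i -> (fun n =>
  (killed_prob [set i] (h n) i - 1) / h n) @ \oo --> Q i i.
Proof.
move=> nDi.
apply: (squeeze_cvgr (f := fun=> Q i i) (h := fun n =>
  (trans_prob (h n) i i - 1) / h n)).
- apply: nearW => n; rewrite ler_pdivlMr// lerBrDl mulrC killed_prob_stay_ge//=.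
  by rewrite ler_wpM2r ?invr_ge0 ?(ltW (h_gt0 n))// lerD2r
    killed_prob_le_trans// ltW.
- exact: cvg_cst.
- exact: trans_prob_rate_eq.
Qed.

End KilledRates.

Lemma killed_prob_0 i : ~ D i -> killed_prob [set i] 0 i = 1.
Proof.
move=> nDi; rewrite -(pr_setT P i) -(pr_start hX i measurableT) setTI.
congr (pr _ _ _); apply/seteqP; split => w /= => [[//]|Xi]; split => // u.
by rewrite addr0 => /le_anti <-; rewrite Xi.
Qed.

Lemma killed_prob_stay_ge0 h i : ~ D i -> 0 <= h -> 1 + h * Q i i <=
  killed_prob [set i] h i.
Proof.
move=> nDi; rewrite le_eqVlt => /predU1P[<-|h0];
  last exact: killed_prob_stay_ge.
by rewrite mul0r addr0 killed_prob_0.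
Qed.

(** * Regularity in time and the backward equation *)

Lemma killed_prob_off_has_sum B h t i : 0 <= h -> 0 <= t ->
  has_sum (fun j => if j == i then 0 else killed_prob [set j] h i *
    killed_prob B t j)
    (killed_prob B (h + t) i - killed_prob [set i] h i * killed_prob B t i).
Proof. by move=> h0 t0; apply: has_sum_remove; exact: killed_prob_CK. Qed.

(* [killed_prob B (h + t) i] is an average of the numbers [killed_prob B t j] in
   [[0, 1]], with weight at least [1 + h * Q i i] on [j = i]. *)
Lemma killed_prob_lipschitz B t h i : ~ D i -> 0 <= t -> 0 <= h ->
  `|killed_prob B (h + t) i - killed_prob B t i| <= h * - Q i i.
Proof.
move=> nDi t0 h0; have w1 := killed_prob_stay_ge0 nDi h0.
have s := killed_prob_off_has_sum B i h0 t0.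
have s0 : 0 <= killed_prob B (h + t) i - killed_prob [set i] h i *
  killed_prob B t i.
  by apply: ge0_has_sum_ge0 s => j; case: ifP => // _;
    rewrite mulr_ge0 ?killed_prob_ge0.
have s1 : killed_prob B (h + t) i - killed_prob [set i] h i *
  killed_prob B t i <= 1 - killed_prob [set i] h i.
  have s' := has_sum_remove i (killed_prob_has_sumT i h0).
  apply: le_trans (_ : killed_prob setT h i - killed_prob [set i] h i <= _).
    apply: le_has_sum s s' => j; case: ifP => // _.
    by rewrite ler_piMr ?killed_prob_ge0// killed_prob_le1.
  by rewrite lerD2r killed_prob_le1.
have b0 := killed_prob_ge0 B t i; have b1 := killed_prob_le1 B i t0.
have w1' := killed_prob_le1 [set i] i h0.
have : 0 <= (1 - killed_prob [set i] h i) * (1 - killed_prob B t i)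
  by rewrite mulr_ge0// subr_ge0.
have : 0 <= (1 - killed_prob [set i] h i) * killed_prob B t i
  by rewrite mulr_ge0// subr_ge0.
by rewrite ler_norml => *; apply/andP; split; lra.
Qed.

(* [killed_prob] frozen at its value at 0 for negative times, where the paths are
   unconstrained. *)
Definition killed_probx B t i := killed_prob B (Num.max t 0) i.

Lemma killed_probx_ge B t i : 0 <= t -> killed_probx B t i = killed_prob B t i.
Proof. by move=> t0; rewrite /killed_probx; congr killed_prob;
  apply/max_idPl. Qed.

Lemma killed_probx_ge0 B t i : 0 <= killed_probx B t i.
Proof. exact: killed_prob_ge0. Qed.

Lemma max0_ge0 t : 0 <= Num.max t 0.
Proof. by rewrite le_max lexx orbT. Qed.

Lemma killed_probx_le1 B t i : killed_probx B t i <= 1.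
Proof. by rewrite killed_prob_le1// max0_ge0. Qed.

Lemma killed_probx_dist B s t i : ~ D i ->
  `|killed_probx B s i - killed_probx B t i| <= - Q i i * `|s - t|.
Proof.
move=> nDi; wlog st : s t / t <= s.
  move=> H; have [/H//|/ltW/H] := leP t s.
  by rewrite distrC [`|t - s|]distrC.
rewrite /killed_probx; set s' := Num.max s 0; set t' := Num.max t 0.
have ts' : t' <= s' by rewrite /t' /s' ge_max !le_max st lexx !orbT.
have e : s' - t' <= `|s - t|.
  rewrite ger0_norm ?subr_ge0// /s' /t'.
  by case: (leP s 0) => ?; case: (leP t 0) => ?; lra.
have := @killed_prob_lipschitz B t' (s' - t') i nDi (max0_ge0 _).
rewrite subr_ge0 ts' subrK => /(_ isT) h; apply: le_trans h _.
by rewrite mulrC ler_wpM2l// oppr_ge0 q_le0.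
Qed.

Lemma killed_probx_continuous B i : continuous (fun t => killed_probx B t i).
Proof.
move=> t; have [Di|nDi] := pselect (D i).
  rewrite (_ : killed_probx B ^~ i = cst 0); first exact: cvg_cst.
  by apply/funext => s; rewrite /killed_probx killed_prob_D// max0_ge0.
apply/cvgrPdist_lt => e e0.
(* The added 1 keeps the divisor positive when [Q i i = 0]. *)
have c0 : 0 < - Q i i + 1 by have := q_le0 i; lra.
exists (e / (- Q i i + 1)) => /=; first by rewrite divr_gt0.
move=> s /= ts; apply: le_lt_trans (killed_probx_dist B t s nDi) _.
rewrite ltr_pdivlMr// mulrC in ts; apply: le_lt_trans ts.
by rewrite ler_wpM2r// lerDl.
Qed.

(* The row [i] of Q^T P^T(t); the terms with [j] in [D] vanish. *)
Definition generator B t i := fine (xsum (fun j =>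
  (Q i j * killed_probx B t j)%:E)).

Lemma generator_has_sum B t i : has_sum (fun j =>
  Q i j * killed_probx B t j) (generator B t i).
Proof.
have [s hs] := has_sum_norm (q_has_sum i).
have [|r hr] := @dominated_has_sum _ _ (fun j =>
  Q i j * killed_probx B t j) _ _ _ hs.
  by move=> j; rewrite normrM ler_piMr// ger0_norm ?killed_probx_ge0
    ?killed_probx_le1.
by rewrite /generator; rewrite /has_sum in hr *; rewrite hr.
Qed.

Lemma generator_off_has_sum B t i :
  has_sum (fun j => if j == i then 0 else Q i j * killed_probx B t j)
    (generator B t i - Q i i * killed_probx B t i).
Proof. by apply: has_sum_remove; exact: generator_has_sum. Qed.

(** The diagonal term, the only one with a nonpositive rate, is split off; the others are dominated
    by the fixed family [Q i j], [j != i], whose sum is [- Q i i]. *)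
Lemma generator_continuous B i : continuous (fun t => generator B t i).
Proof.
move=> t; rewrite (_ : generator B ^~ i =
    (fun s => (generator B s i - Q i i * killed_probx B s i) + Q i i *
      killed_probx B s i)); last first.
  by apply/funext => s; rewrite subrK.
apply: cvgD; last by apply: cvgM; [exact: cvg_cst|exact:
  killed_probx_continuous].
apply: (@pratt _ _ _ (nbhs t) (fun _ j => if j == i then 0 else Q i j)
  (fun s j => if j == i then 0 else Q i j * killed_probx B s j) (fun=> - Q i i)
    _
  (fun j => if j == i then 0 else Q i j)
  (fun j => if j == i then 0 else Q i j * killed_probx B t j) (- Q i i)).
- apply: nearW => s; split; [|exact: q_off_has_sum|exact:
  generator_off_has_sum].
  move=> j; case: eqVneq => [_|ji]; first by rewrite lexx.
  rewrite eq_sym in ji.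
  by rewrite mulr_ge0 ?q_ge0 ?killed_probx_ge0//= ler_piMr ?q_ge0//
    killed_probx_le1.
- by move=> j; exact: cvg_cst.
- move=> j; case: eqVneq => _; first exact: cvg_cst.
  by apply: cvgM; [exact: cvg_cst|exact: killed_probx_continuous].
- exact: cvg_cst.
- exact: q_off_has_sum.
- exact: generator_off_has_sum.
Qed.

(* The dominating family is [p_ij(h) / h], [j != i]: its total mass
   [(1 - p_ii(h)) / h] tends to [- Q i i], which is the sum of its limits since
   [Q] is conservative. The point [s n] moves so as to cover both the left and
   the right derivative. *)
Lemma backward_cvg B t i (h s : nat -> R) : ~ D i -> 0 <= t ->
  (forall n, 0 < h n) -> h @ \oo --> 0 -> (\forall n \near \oo, 0 <= s n) ->
  s @ \oo --> t ->
  (fun n => (killed_prob B (h n + s n) i - killed_prob B (s n) i) / h n) @ \oo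
    --> generator B t i.
Proof.
move=> nDi t0 h0 hc s0 sc.
have kc j : (fun n => killed_probx B (s n) j) @ \oo --> killed_probx B t j.
  exact: (cvg_comp _ _ sc (@killed_probx_continuous B j t)).
have -> : generator B t i = (generator B t i - Q i i * killed_probx B t i) +
  Q i i * killed_probx B t i by rewrite subrK.
(* The contribution to the difference quotient of the paths that are away from [i] after time
   [h n]. *)
pose C n := (killed_prob B (h n + s n) i - killed_prob [set i] (h n) i *
  killed_prob B (s n) i) / h n.
have cC : C @ \oo --> generator B t i - Q i i * killed_probx B t i.
  apply: (@pratt _ _ _ \oo (fun n j => if j == i then 0 else trans_prob (h n) i
    j / h n)
    (fun n j => if j == i then 0 else killed_prob [set j] (h n) i / h n *
      killed_probx B (s n) j)
    (fun n => - ((trans_prob (h n) i i - 1) / h n)) C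
    (fun j => if j == i then 0 else Q i j)
    (fun j => if j == i then 0 else Q i j * killed_probx B t j) (- Q i i)).
  - near=> n; have hn := h0 n; have hn0 := ltW hn.
    have sn : 0 <= s n by near: n.
    split.
    + move=> j; case: eqVneq => [_|ji]; first by rewrite lexx.
      rewrite mulr_ge0 ?killed_probx_ge0 ?divr_ge0 ?killed_prob_ge0//=.
      apply: le_trans (_ : killed_prob [set j] (h n) i / h n <= _).
        by rewrite ler_piMr ?killed_probx_le1// divr_ge0 ?killed_prob_ge0.
      by rewrite ler_wpM2r ?invr_ge0// killed_prob_le_trans.
    + rewrite -mulNr opprB mulrC.
      apply: eq_has_sum (has_sumZ (h n)^-1 (has_sum_remove i (trans_prob_has_sum
        i hn0))) => j.
      by case: ifP => _; rewrite ?mulr0// mulrC.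
    + rewrite /C mulrC; apply: eq_has_sum (has_sumZ (h n)^-1
      (killed_prob_off_has_sum B i hn0 sn)) => j.
      by case: ifP => _; rewrite ?mulr0// killed_probx_ge//; ring.
  - move=> j; case: eqVneq => [_|ji]; first exact: cvg_cst.
    by apply: trans_prob_rate_neq => //; rewrite eq_sym.
  - move=> j; case: eqVneq => [_|ji]; first exact: cvg_cst.
    (* For [j] in [D] the killed probability of reaching [j] is 0 and its rate is not [Q i j], but
       survival from [j] is 0 too, so both sides vanish. *)
    have [Dj|nDj] := pselect (D j).
      rewrite (_ : (fun _ => _) = cst 0).
        by rewrite /killed_probx killed_prob_D// ?mulr0 ?max0_ge0//;
          exact: cvg_cst.
      apply/funext => n; rewrite /killed_probx [X in _ *
        X]killed_prob_D ?mulr0 ?max0_ge0//.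
    by apply: cvgM; [apply: killed_prob_rate_neq => //;
      rewrite eq_sym|exact: kc].
  - by apply: cvgN; exact: trans_prob_rate_eq.
  - exact: q_off_has_sum.
  - exact: generator_off_has_sum.
have c2 : (fun n => C n + (killed_prob [set i] (h n) i - 1) / h n *
  killed_probx B (s n) i) @ \oo -->
    (generator B t i - Q i i * killed_probx B t i) + Q i i * killed_probx B t i.
  by apply: cvgD => //; apply: cvgM; [exact: killed_prob_rate_eq|exact: kc].
apply: cvg_trans c2; apply: near_eq_cvg; near=> n.
have sn : 0 <= s n by near: n.
by rewrite /C killed_probx_ge//; field; rewrite gt_eqF.
Unshelve. all: by end_near.
Qed.

Lemma killed_prob_is_derive B t i : ~ D i -> 0 < t -> is_derive t 1 (fun u =>
  killed_prob B u i) (generator B t i).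
Proof.
move=> nDi t0.
suff c : (fun h => h^-1 *: (killed_prob B (h *: 1 +
  t) i - killed_prob B t i)) @ 0^' --> generator B t i.
  have dv : derivable (fun u => killed_prob B u i) t 1 by apply/cvg_ex;
    exists (generator B t i).
  by apply: DeriveDef => //; apply: cvg_lim.
apply: (@cvg_at_right_left_dnbhs _ R^o).
  apply/cvg_at_rightP => h [h0 hc].
  apply: cvg_trans (@backward_cvg B t i h (fun=> t) nDi (ltW t0) h0 hc _
    (cvg_cst _)); last first.
    by apply: nearW => n; exact: ltW.
  by apply: near_eq_cvg; apply: nearW => n /=;
    rewrite /GRing.scale/= mulr1 mulrC.
(* A negative increment [h n] is the positive step [- h n] taken from the moving point [h n + t]. *)
apply/cvg_at_leftP => h [h0 hc].
have hNc : (fun n => - h n) @ \oo --> 0 by rewrite -oppr0; exact: cvgN.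
have tc : (fun n => h n + t) @ \oo --> t.
  by rewrite -[X in _ --> X]add0r; apply: cvgD => //; exact: cvg_cst.
have hN0 n : 0 < - h n by rewrite oppr_gt0.
apply: cvg_trans (@backward_cvg B t i (fun n => - h n) (fun n =>
  h n + t) nDi (ltW t0) hN0 hNc _ tc); last first.
  near=> n; apply: ltW; near: n; exact: (cvgr_gt _ tc).
apply: near_eq_cvg; apply: nearW => n /=.
rewrite addKr invrN mulrN -mulNr opprB /GRing.scale/= mulr1 mulrC.
by [].
Unshelve. all: by end_near.
Qed.

(** Keep only the paths that are at [k] at time [t] and again after the extra time [h]: their
    probability is at least [p_ik(t) (1 + h q_kk)]. Dividing the increment by [h] and letting [h]
    tend to 0 bounds the derivative from below, uniformly in [i]. *)
Lemma generator_ge t i k : ~ D i -> ~ D k -> 0 <= t ->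
  Q k k * killed_probx [set k] t i <= generator [set k] t i.
Proof.
move=> nDi nDk t0.
have c := @backward_cvg [set k] t i (@harmonic R) (fun=> t) nDi t0
  (@harmonic_gt0 R)
  (@cvg_harmonic R) (nearW _ (fun _ => t0)) (cvg_cst _).
apply: (cvgr_to_ge (c _ _)); apply: nearW => n.
have n0 := @harmonic_gt0 R n.
have n00 := ltW n0.
rewrite ler_pdivlMr// killed_probx_ge// lerBrDl addrC.
have w := killed_prob_stay_ge n0 nDk.
rewrite (addrC (harmonic n) t).
apply: le_trans (has_sum_ge_term k _ (killed_prob_CK [set k] i t0 n00));
  last first.
  by move=> j; rewrite mulr_ge0 ?killed_prob_ge0.
have : killed_prob [set k] t i * (1 + harmonic n * Q k k) <=
  killed_prob [set k] t i * killed_prob [set k] (harmonic n) k.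
  by rewrite ler_wpM2l ?killed_prob_ge0.
by apply: le_trans; rewrite le_eqVlt; apply/orP; left; apply/eqP; ring.
Qed.

End Killed.

(** * Termwise integration *)
Section TermwiseIntegration.
Variable R : realType.
Notation leb := (@lebesgue_measure R).

(** The integrand is computed only for [t > 0], where derivatives are two-sided; the point 0 affects
    neither measurability nor the integral. *)
Lemma integrable_eq_pos (F G : R -> \bar R) (b : R) : 0 < b ->
  (forall t : R, 0 < t -> F t = G t) -> leb.-integrable `[0, b] G ->
  leb.-integrable `[0, b] F /\
  (\int[leb]_(t in `[0%R, b]) F t = \int[leb]_(t in `[0%R, b]) G t)%E.
Proof.
move=> b0 FG iG; have /integrableP[mG fG] := iG.
have FG' t : t \in `]0%R, b]%classic -> F t = G t.
  by rewrite inE/= in_itv/= => /andP[t0 _]; exact: FG.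
have mG' : measurable_fun `]0, b] G by apply/emeasurable_fun_itv_obnd_cbndP.
have mF' : measurable_fun `]0, b] F.
  by apply: eq_measurable_fun mG' => t tb; rewrite FG'.
have mF : measurable_fun `[0, b] F by apply/emeasurable_fun_itv_obnd_cbndP.
split.
  apply/integrableP; split => //.
  rewrite -integral_itv_obnd_cbnd; last exact: measurableT_comp.
  under eq_integral => t tb do rewrite (FG' t tb).
  by rewrite integral_itv_obnd_cbnd//; exact: measurableT_comp.
rewrite -integral_itv_obnd_cbnd// -[RHS]integral_itv_obnd_cbnd//.
exact: eq_integral.
Qed.

Lemma improper_integral_eq_pos (F G : R -> \bar R) (l : R) :
  (forall t : R, 0 < t -> F t = G t) -> improper_integral_is G l ->
    improper_integral_is F l.
Proof.
move=> FG [iG cG]; split=> [b b0|].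
  by have [] := integrable_eq_pos b0 FG (iG b b0).
apply: cvg_trans cG; apply: near_eq_cvg; near=> b.
have b0 : 0 < b by near: b; exact: nbhs_pinfty_gt.
by have [_ ->] := integrable_eq_pos b0 FG (iG b b0).
Unshelve. all: by end_near.
Qed.

(** * Fundamental theorem of calculus for series with derivatives bounded below *)

Section Series.
Variables (I : countType) (m : I -> R) (u v : I -> R ->
  R) (c s b K : R) (W M : R -> R).
Hypothesis m_ge0 : forall x, 0 <= m x.
Hypothesis m_sum : has_sum m s.
Hypothesis b_gt0 : 0 < b.
Hypothesis u_cont : forall x, continuous (u x).
Hypothesis v_cont : forall x, continuous (v x).
Hypothesis u_derive : forall x (t : R), 0 < t ->
  is_derive t (1 : R) (u x) (v x t).
Hypothesis vu_ge0 : forall x (t : R), 0 <= t -> 0 <= v x t + c * u x t.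
Hypothesis u_bound : forall x (t : R), 0 <= t <= b -> 0 <= u x t <= K.
Hypothesis W_sum : forall t : R, 0 <= t -> has_sum (fun x => m x * u x t) (W t).
Hypothesis M_sum : forall t : R, 0 < t -> has_sum (fun x => m x * v x t) (M t).

Let D : set R := `[0, b].

Let mD : measurable (D : set (measurableTypeR R)). Proof. exact: measurable_itv.
  Qed.

Let inD t : D t -> 0 <= t <= b. Proof. by rewrite /D /= in_itv. Qed.

Let int_cont (f : R -> R) : continuous f -> leb.-integrable D (EFin \o f).
Proof.
move=> cf; apply: continuous_compact_integrable; first exact: segment_compact.
exact: continuous_subspaceT.
Qed.

Let meas_cont (f : R -> R) : continuous f -> measurable_fun D (EFin \o f).
Proof. by move=> /int_cont/measurable_int. Qed.

Let r x := fine (\int[leb]_(t in D) (u x t)%:E)%E.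

Let rE x : (\int[leb]_(t in D) (u x t)%:E = (r x)%:E)%E.
Proof. by rewrite /r fineK//; apply: integrable_fin_num => //;
  exact: int_cont. Qed.

Let r_bound x : 0 <= r x <= K * b.
Proof.
rewrite -!lee_fin -rE; apply/andP; split.
  by apply: integral_ge0 => t /inD/(u_bound x); rewrite lee_fin => /andP[].
apply: (@le_trans _ _ (\int[leb]_(t in D) cst K%:E t)%E).
  apply: ge0_le_integral => //.
  - by move=> t /inD/(u_bound x); rewrite lee_fin => /andP[].
  - exact: (measurable_int leb (int_cont (@u_cont x))).
  - by move=> t /inD/(u_bound x); rewrite lee_fin => /andP[].
rewrite integral_cst//= lebesgue_measure_itv/= lte_fin b_gt0 sube0.
by rewrite -EFinM.
Qed.

Let v_int x : (\int[leb]_(t in D) (v x t)%:E = (u x b - u x 0)%:E)%E.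
Proof.
rewrite (@continuous_FTC2 _ _ (u x) 0 b)//.
- exact: continuous_subspaceT.
- split.
  + by move=> t; rewrite in_itv/= => /andP[t0 _]; have [] := u_derive x t0.
  + by apply: cvg_at_right_filter; exact: u_cont.
  + by apply: cvg_at_left_filter; exact: u_cont.
- move=> t; rewrite in_itv/= => /andP[t0 _]; rewrite derive1E.
  by have [] := u_derive x t0.
Qed.

Let vu_int x : (\int[leb]_(t in D) (m x * (v x t + c * u x t))%:E =
  (m x * (u x b - u x 0 + c * r x))%:E)%E.
Proof.
have cvu : continuous (fun t => v x t + c * u x t).
  move=> t; apply: cvgD; first exact: v_cont.
  by apply: cvgM; [exact: cvg_cst|exact: u_cont].
have ccu : continuous (fun t => c * u x t).
  by move=> t; apply: cvgM; [exact: cvg_cst|exact: u_cont].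
under eq_integral do rewrite EFinM.
rewrite integralZl//; last exact: int_cont.
have -> : (\int[leb]_(t in D) (v x t + c * u x t)%:E =
    \int[leb]_(t in D) (v x t)%:E + \int[leb]_(t in D) (c * u x t)%:E)%E.
  exact: (integralD_EFin mD (int_cont (@v_cont x)) (int_cont ccu)).
under [X in (_ * (_ + X))%E]eq_integral do rewrite EFinM.
by rewrite integralZl ?rE ?v_int//; exact: int_cont.
Qed.

Let u_int x : (\int[leb]_(t in D) (m x * u x t)%:E = (m x * r x)%:E)%E.
Proof.
under eq_integral do rewrite EFinM.
by rewrite integralZl// ?rE//; exact: int_cont.
Qed.

(* Termwise monotone convergence applies to [v + c * u >= 0] and to [u], whereas
   [v] itself has no integrable majorant. *)
Lemma termwise_integral : leb.-integrable D (EFin \o M) /\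
  (\int[leb]_(t in D) (M t)%:E = (W b - W 0)%:E)%E.
Proof.
pose H t := (\esum_(x in [set: I]) (m x * u x t)%:E)%E.
pose G t := (\esum_(x in [set: I]) (m x * (v x t + c * u x t))%:E)%E.
(* [rho] is the integral of [H]; its finiteness, from [u <= K] and the finite mass of [m], allows
   the later subtraction. *)
have [rho rhoE] : exists rho, has_sum (fun x => m x * r x) rho.
  apply: (@ge0_dominated_has_sum _ _ _ (fun x => K * b * m x)).
    move=> x; have /andP[r0 rK] := r_bound x.
    by rewrite mulr_ge0//= mulrC ler_wpM2r.
  exact: has_sumZ m_sum.
have mu0 x t : D t -> (0 <= (m x * u x t)%:E)%E.
  by move=> /inD/(u_bound x)/andP[u0 _]; rewrite lee_fin mulr_ge0.
have mvu0 x t : D t -> (0 <= (m x * (v x t + c * u x t))%:E)%E.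
  by move=> /inD/andP[t0 _]; rewrite lee_fin mulr_ge0// vu_ge0.
have mmu x : measurable_fun D (fun t => (m x * u x t)%:E).
  by apply: (@meas_cont (fun t => m x * u x t)) => t; apply: cvgM;
    [exact: cvg_cst|exact: u_cont].
have mmvu x : measurable_fun D (fun t => (m x * (v x t + c * u x t))%:E).
  apply: (@meas_cont (fun t => m x * (v x t + c * u x t))) => t.
  apply: cvgM; [exact: cvg_cst|apply: cvgD; [exact: v_cont|]].
  by apply: cvgM; [exact: cvg_cst|exact: u_cont].
have mH : measurable_fun D H by apply: measurable_esum.
have mG : measurable_fun D G by apply: measurable_esum.
have H0 t : D t -> (0 <= H t)%E by move=> Dt; apply: esum_ge0 => x _;
  exact: mu0.
have G0 t : D t -> (0 <= G t)%E by move=> Dt; apply: esum_ge0 => x _;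
  exact: mvu0.
have iH : (\int[leb]_(t in D) H t = rho%:E)%E.
  rewrite ge0_integral_esum//; under eq_esum do rewrite u_int.
  apply/ge0_has_sumE => // x; rewrite mulr_ge0//.
  by case/andP: (r_bound x).
(* Termwise, each integral is the increment of [u x] over [[0, b]] plus [c] times the integral of
   [u x]. *)
have iG : (\int[leb]_(t in D) G t = (W b - W 0 + c * rho)%:E)%E.
  rewrite ge0_integral_esum//; under eq_esum do rewrite vu_int.
  apply/ge0_has_sumE => [x|].
    by rewrite -lee_fin -vu_int; apply: integral_ge0 => t; exact: mvu0.
  have := has_sumD (has_sumB (W_sum (ltW b_gt0)) (W_sum (lexx 0))) (has_sumZ c
    rhoE).
  by apply: eq_has_sum => x; ring.
have intH : leb.-integrable D H.
  apply/integrableP; split=> //.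
  have -> : (\int[leb]_(t in D) `|H t| = \int[leb]_(t in D) H t)%E.
    by apply: eq_integral => t /set_mem Dt; rewrite gee0_abs// H0.
  by rewrite iH ltry.
have intG : leb.-integrable D G.
  apply/integrableP; split=> //.
  have -> : (\int[leb]_(t in D) `|G t| = \int[leb]_(t in D) G t)%E.
    by apply: eq_integral => t /set_mem Dt; rewrite gee0_abs// G0.
  by rewrite iG ltry.
have intcH : leb.-integrable D (fun t => c%:E * H t)%E by exact: integrableZl.
pose GH := (G \- (fun t => c%:E * H t))%E.
have MGH : forall t : R, 0 < t -> D t -> (M t)%:E = GH t.
  move=> t t0 Dt; have t00 := ltW t0.
  rewrite /GH /= (_ : H t = (W t)%:E); last first.
    by apply/ge0_has_sumE => [x|]; [rewrite -lee_fin mu0|exact: W_sum].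
  rewrite (_ : G t = (M t + c * W t)%:E); last first.
    apply/ge0_has_sumE => [x|]; first by rewrite -lee_fin mvu0.
    by apply: eq_has_sum (has_sumD (M_sum t0) (has_sumZ c (W_sum t00))) => x;
      ring.
  by rewrite -EFinM -EFinB addrK.
have intGH : leb.-integrable D GH by exact: integrableB.
(* [integrable_eq_pos] asks for equality at every positive time, whereas [M = GH] is known only up
   to [b]. *)
pose GH' t := if t <= b then GH t else (M t)%:E.
have GHGH' : {in D, GH =1 GH'}.
  by move=> t /set_mem/inD/andP[_ tb]; rewrite /GH' tb.
have MGH' t : 0 < t -> (EFin \o M) t = GH' t.
  rewrite /GH' => t0; case: ifPn => // tb; apply: MGH => //.
  by rewrite /D /= in_itv/= tb ltW.
have intGH' : leb.-integrable D GH' by apply: eq_integrable intGH.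
have [i1 i2] := integrable_eq_pos b_gt0 MGH' intGH'.
have i3 : (\int[leb]_(t in D) GH' t = \int[leb]_(t in D) GH t)%E.
  by apply: eq_integral => t /GHGH' ->.
split => //; rewrite [LHS](etrans i2 i3) integralB// iG.
by rewrite integralZl// iH -EFinM -EFinB addrK.
Qed.

End Series.
End TermwiseIntegration.

(** * The matrices indexed by E_Delta *)
Section KilledOnE.
Variables (R : realType) (d : measure_display) (Omega : measurableType d).
Variables (S : countType) (P : S -> probability Omega R) (X : R -> Omega -> S).
Variables (Q : S -> S -> R) (D : set S).
Hypothesis hX : markov_chain P X Q.
Local Notation live := {i | i \in ~` D}.
Local Notation state := (option live).
Implicit Types (i j k : state) (x y : live) (B : set S) (s t : R) (mu : state ->
  R).

Lemma live_notD x : ~ D (val x).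
Proof. by have := valP x; rewrite inE. Qed.

Lemma has_sum_live (f : S -> R) r : (forall j : S, D j -> f j = 0) ->
  has_sum f r -> has_sum (fun x : live => f (val x)) r.
Proof.
move=> fD; apply: (iffRL (@has_sum_inj R _ S (fun x : live => val x) f r _ _)).
  exact: val_inj.
move=> j nj; apply: fD; apply: contrapT => nDj; apply: nj.
have jE : j \in ~` D by rewrite inE.
by exists (exist _ j jE).
Qed.

Definition killed_prob_state B t i : R :=
  if i is Some x then killed_prob P X D B t (val x) else 0.

Definition generator_state B t i : R :=
  if i is Some x then generator P X Q D B t (val x) else 0.

(** The cemetery column is the complement of survival. As [killed_prob_state] vanishes at [None],
    the row of [None] comes out as the unit mass at [None]. *)
Definition state_semigroup t i k : R :=
  if k is Some y then killed_prob_state [set val y] t i else 1 -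
    killed_prob_state setT t i.

Definition state_generator t i k : R :=
  if k is Some y then generator_state [set val y] t i else - generator_state
    setT t i.

Definition fine_killing_rate x : R := fine (killing_rate Q x).

Definition state_qmatrix i j : R :=
  match i, j with
  | Some x, Some y => Q (val x) (val y)
  | Some x, None => fine_killing_rate x
  | None, _ => 0
  end.

Lemma killed_prob_state_ge0 B t i : 0 <= killed_prob_state B t i.
Proof. by case: i => //= x; exact: killed_prob_ge0. Qed.

Lemma killed_prob_state_le1 B t i : 0 <= t -> killed_prob_state B t i <= 1.
Proof. by case: i => //= x t0; exact: (killed_prob_le1 _ hX). Qed.

Lemma P_survival B t (i : S) : 0 <= t ->
  P i (survival X D t `&` [set w | B (X t w)]) = (killed_prob P X D B t i)%:E.
Proof.
move=> t0; rewrite (survivalE D hX t0) /killed_prob -(prE P)//.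
exact: (killed_prob_measurable _ hX).
Qed.

Lemma P_survivalT t (i : S) : 0 <= t -> P i (survival X D t) =
  (killed_prob P X D setT t i)%:E.
Proof.
by move=> t0; rewrite -P_survival//; congr (P i _); apply/seteqP;
  split => w //= -[].
Qed.

Lemma killed_semigroupE t i k : 0 <= t -> killed_semigroup P X t i k =
  (state_semigroup t i k)%:E.
Proof.
move=> t0; case: i => [x|]; case: k => [y|] //=; rewrite ?subr0//.
  rewrite -P_survival//; congr (P _ _); apply/seteqP.
  by split => w /=; rewrite /survival /=; tauto.
have mS : measurable (survival X D t).
  by rewrite (survivalE D hX t0); exact: (measurable_avoid D hX).
rewrite EFinB -P_survivalT// -probability_setC//; congr (P _ _).
by apply/seteqP; split => w /=; rewrite /survival /= leNgt => /negP.
Qed.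

Lemma fine_killing_rate_has_sum x :
  has_sum (fun j : S => if j \in D then Q (val x) j else 0) (fine_killing_rate
    x).
Proof.
have [s hs] := has_sum_norm (q_has_sum hX (val x)).
have q0 (j : S) : 0 <= (if j \in D then Q (val x) j else 0).
  case: ifPn => //; rewrite inE => Dj; apply: (q_ge0 hX).
  by apply/eqP => E; apply: (@live_notD x); rewrite E.
have [|r hr] := @ge0_dominated_has_sum _ _ (fun j : S =>
  if j \in D then Q (val x) j else 0) _ _ _ hs.
  by move=> j; rewrite q0/=; case: ifP => // _; rewrite ler_norm.
suff -> : fine_killing_rate x = r by [].
move/(ge0_has_sumE _ q0): hr => hr; rewrite /fine_killing_rate /killing_rate
  esum_mkcond.
have -> : (\esum_(j in [set: S]) (if j \in D then (Q (val x) j)%:E else 0) =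
    \esum_(j in [set: S]) (if j \in D then Q (val x) j else 0)%:E)%E.
  by apply: eq_esum => j _; case: ifP.
by rewrite hr.
Qed.

(** The killing rates are finite because each row of a conservative [Q] is absolutely summable. *)
Lemma killed_qmatrixE i j : killed_qmatrix Q i j = (state_qmatrix i j)%:E.
Proof.
case: i => [x|] //=; case: j => [y|] //=; rewrite /fine_killing_rate fineK//.
have [s hs] := has_sum_norm (q_has_sum hX (val x)).
have n0 (j : S) : 0 <= `|Q (val x) j| by [].
move/(ge0_has_sumE _ n0): hs => hs.
have q0 (j : S) : D j -> (0 <= (Q (val x) j)%:E)%E.
  move=> Dj; rewrite lee_fin; apply: (q_ge0 hX).
  by apply/eqP => E; apply: (@live_notD x); rewrite E.
rewrite ge0_fin_numE; last exact: esum_ge0.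
apply: (@le_lt_trans _ _ s%:E); last exact: ltry.
rewrite -hs /killing_rate esum_mkcond; apply: le_esum => j _.
by case: ifP => _; rewrite lee_fin ?ler_norm.
Qed.

Lemma state_generator_has_sum t i k : 0 <= t -> has_sum (fun j =>
  state_qmatrix i j * state_semigroup t j k) (state_generator t i k).
Proof.
move=> t0; case: i => [x|]; last first.
  have -> : state_generator t None k = 0 by case: k => //=; rewrite oppr0.
  by apply: eq_has_sum (has_sum0 _ _) => j /=; rewrite mul0r.
have gl B : has_sum (fun y => Q (val x) (val y) *
  killed_prob_state B t (Some y))
    (generator P X Q D B t (val x)).
  have := has_sum_live _ (generator_has_sum D hX B t (val x)).
  move=> /(_ _)/eq_has_sum; apply => [y /=|j Dj];
    first by rewrite killed_probx_ge.
  by rewrite /killed_probx (killed_prob_D hX) ?mulr0 ?max0_ge0.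
case: k => [y|] /=.
  have := has_sum_option (f := fun j =>
    state_qmatrix (Some x) j * killed_prob_state [set val y] t j) (gl [set val
      y]).
  by rewrite /= mulr0 add0r.
(* By conservativity, the rates inside [E] sum to minus the killing rate. This cancels the term at
   [None], where survival is 0, and leaves minus the survival generator. *)
have ql : has_sum (fun y => Q (val x) (val y)) (- fine_killing_rate x).
  have h := has_sumB (q_has_sum hX (val x)) (fine_killing_rate_has_sum x).
  rewrite sub0r in h.
  have := has_sum_live _ h.
  move=> /(_ _)/eq_has_sum; apply => [y /=|j Dj];
    last by rewrite mem_set// subrr.
  by rewrite memNset ?subr0//; exact: live_notD.
pose f j := state_qmatrix (Some x) j * (1 - killed_prob_state setT t j).
have h : has_sum f (f None + (- fine_killing_rate x - generator P X Q D setT t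
  (val x))).
  by apply: has_sum_option; apply: eq_has_sum (has_sumB ql (gl setT)) => y;
    rewrite /f /=; ring.
suff <- : f None + (- fine_killing_rate x - generator P X Q D setT t (val x)) =
  - generator P X Q D setT t (val x) by [].
by rewrite /f /=; ring.
Qed.

Lemma killed_prob_0_neq (x : S) B : ~ B x -> killed_prob P X D B 0 x = 0.
Proof.
move=> nB; rewrite /killed_prob -(pr_start hX);
  last exact: (killed_prob_measurable _ hX).
by apply: pr_eq0 => w /= [[_ Bx] Xx]; apply: nB; rewrite -Xx.
Qed.

Lemma killed_prob_state_0 y i : killed_prob_state [set val y] 0 i =
  (i == Some y)%:R.
Proof.
case: i => [x|] //=; have [[<-]|xy] := eqVneq (Some x) (Some y).
  by rewrite (killed_prob_0 hX)//; exact: live_notD.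
rewrite killed_prob_0_neq// => /= /val_inj E; by rewrite E eqxx in xy.
Qed.

Lemma killed_prob_state_is_derive B t i : 0 < t -> is_derive t (1 : R) (fun u =>
  killed_prob_state B u i) (generator_state B t i).
Proof.
move=> t0; case: i => [x|] /=; first by apply: (killed_prob_is_derive hX) => //;
  exact: live_notD.
exact: is_derive_cst.
Qed.

Lemma killed_semigroup_derivE t i k : 0 < t ->
  killed_semigroup_deriv P X t i k = (state_generator t i k)%:E.
Proof.
move=> t0; rewrite /killed_semigroup_deriv derive1E; congr EFin.
have pd : is_derive t (1 : R) (fun s =>
  state_semigroup s i k) (state_generator t i k).
  case: k => [y|] /=; first exact: killed_prob_state_is_derive.
  have h := killed_prob_state_is_derive setT i t0.
  rewrite -[X in is_derive _ _ _ X]sub0r.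
  have h1 : is_derive t (1 : R) (fun=> 1 : R) 0 by exact: is_derive_cst.
  exact: (is_deriveB h1 h).
rewrite (near_eq_derive _ (g := fun s => state_semigroup s i k));
  first by have [] := pd.
near=> s; have s0 : 0 < s by near: s; exact: lt_nbhsr.
by rewrite killed_semigroupE// ltW.
Unshelve. all: by end_near.
Qed.

Lemma matmul_backward t i k : 0 <= t ->
  matmul (killed_qmatrix Q) (killed_semigroup P X t) i k =
    (state_generator t i k)%:E.
Proof.
move=> t0; rewrite -(state_generator_has_sum i k t0) /matmul; congr xsum;
  apply/funext => j.
by rewrite killed_qmatrixE killed_semigroupE// EFinM.
Qed.

End KilledOnE.

(** * The process started from a distribution *)
Section Mixture.
Variables (R : realType) (d : measure_display) (Omega : measurableType d).
Variables (S : countType) (P : S -> probability Omega R) (X : R -> Omega -> S).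
Variables (Q : S -> S -> R) (D : set S).
Hypothesis hX : markov_chain P X Q.
Local Notation live := {i | i \in ~` D}.
Local Notation state := (option live).
Local Notation killed_prob_state := (@killed_prob_state R d Omega S P X D).
Local Notation state_semigroup := (@state_semigroup R d Omega S P X D).
Implicit Types (i j k : state) (x y : live) (B : set S) (s t : R).

Section OneLaw.
Variable mu : state -> R.
Hypothesis hmu : distribution_on mu.

Let mu0 i : 0 <= mu i. Proof. by case: hmu. Qed.

Lemma distribution_has_sum : has_sum mu 1.
Proof. by case: hmu => m0 _ m1; apply/ge0_has_sumE. Qed.

Lemma has_sum_noncemetery (f : state -> R) r : f None = 0 ->
  has_sum f r -> has_sum (fun x => f (Some x)) r.
Proof.
move=> f0; apply: (iffRL (@has_sum_inj R _ _ (fun x : live => Some x) f r _ _)).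
  by move=> x y [].
by case=> [x nx|//]; exfalso; apply: nx; exists x.
Qed.

Definition mixed_prob B t : R := fine (xsum (fun i =>
  (mu i * killed_prob_state B t i)%:E)).

Lemma mixed_prob_has_sum B t : 0 <= t -> has_sum (fun i =>
  mu i * killed_prob_state B t i) (mixed_prob B t).
Proof.
move=> t0.
have [|r hr] := @ge0_dominated_has_sum _ _ (fun i =>
  mu i * killed_prob_state B t i) _ _ _ distribution_has_sum.
  by move=> i; rewrite mulr_ge0 ?killed_prob_state_ge0//= ler_piMr//
    (killed_prob_state_le1 hX).
by rewrite /mixed_prob; rewrite /has_sum in hr *; rewrite hr.
Qed.

Lemma mixed_prob_ge0 B t : 0 <= t -> 0 <= mixed_prob B t.
Proof.
by move=> t0; apply: ge0_has_sum_ge0 (mixed_prob_has_sum B t0) => i;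
  rewrite mulr_ge0 ?killed_prob_state_ge0.
Qed.

Lemma mixed_prob_live B t : 0 <= t ->
  has_sum (fun x => mu (Some x) * killed_prob P X D B t (val x)) (mixed_prob B
    t).
Proof.
by move=> t0; apply: has_sum_noncemetery (mixed_prob_has_sum B t0);
  rewrite /= mulr0.
Qed.

Lemma law_mixed_prob B t : 0 <= t ->
  law P mu (survival X D t `&` [set w | B (X t w)]) = (mixed_prob B t)%:E.
Proof.
move=> t0; have /(ge0_has_sumE _ _) := mixed_prob_live B t0.
move=> <-; last by move=> x; rewrite mulr_ge0// killed_prob_ge0.
by apply: eq_esum => x _; rewrite (P_survival D hX)// EFinM.
Qed.

Lemma law_survival t : 0 <= t -> law P mu (survival X D t) =
  (mixed_prob setT t)%:E.
Proof.
by move=> t0; rewrite -law_mixed_prob//; congr law; apply/seteqP;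
  split => w // -[].
Qed.

Lemma mixed_prob_0 y : mixed_prob [set val y] 0 = mu (Some y).
Proof.
apply: has_sum_unique (mixed_prob_has_sum _ (lexx 0)) _.
have := @has_sum1 R _ (Some y) (fun i =>
  mu i * killed_prob_state [set val y] 0 i).
rewrite (killed_prob_state_0 hX) eqxx mulr1; apply=> i /negbTE iy.
by rewrite (killed_prob_state_0 hX) iy mulr0.
Qed.

Lemma mixed_prob_total t : 0 <= t -> has_sum (fun y =>
  mixed_prob [set val y] t) (mixed_prob setT t).
Proof.
move=> t0.
apply: (@ge0_has_sum_exchange R _ _ (fun x y =>
  mu (Some x) * killed_prob P X D [set val y] t (val x))
  (fun x => mu (Some x) * killed_prob P X D setT t (val x))).
- by move=> x y; rewrite mulr_ge0// killed_prob_ge0.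
- move=> x; apply: has_sumZ.
  by apply: (has_sum_live _ (killed_prob_has_sumT D hX (val x) t0)) => k Dk;
    rewrite killed_prob_Dr.
- by move=> y; exact: mixed_prob_live.
- exact: mixed_prob_live.
Qed.

Lemma mixed_prob_CK B s t : 0 <= s -> 0 <= t ->
  has_sum (fun y => mixed_prob [set val y] s *
    killed_prob P X D B t (val y)) (mixed_prob B (s + t)).
Proof.
move=> s0 t0; have st0 : 0 <= s + t by rewrite addr_ge0.
apply: (@ge0_has_sum_exchange R _ _
  (fun x y => mu (Some x) * (killed_prob P X D [set val y] s (val x) *
    killed_prob P X D B t (val y)))
  (fun x => mu (Some x) * killed_prob P X D B (s + t) (val x))).
- by move=> x y; rewrite !mulr_ge0// killed_prob_ge0.
- move=> x; apply: has_sumZ.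
  apply: (has_sum_live _ (killed_prob_CK D hX B (val x) s0 t0)) => k Dk.
  by rewrite killed_prob_Dr ?mul0r.
- move=> y; rewrite mulrC.
  apply: eq_has_sum (has_sumZ (killed_prob P X D B t (val y)) (mixed_prob_live
    [set val y] s0)) => x.
  by ring.
- exact: mixed_prob_live.
Qed.

Lemma cond_law_live t y : 0 <= t ->
  cond_law P X mu t (Some y) = mixed_prob [set val y] t / mixed_prob setT t.
Proof.
move=> t0; rewrite /cond_law law_survival//=; congr (_ / _).
rewrite -[RHS]/(fine (mixed_prob [set val y] t)%:E) -law_mixed_prob//;
  congr (fine (law _ _ _)).
apply/seteqP; split => w /= [].
  rewrite /killed /survival /= => + tT; rewrite tT => E; split => //=.
  by move: E; case: insubP => // u _ <- [->].
rewrite /killed /survival /= => tT Xy; split => //; rewrite tT.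
by rewrite Xy valK.
Qed.

Lemma cond_law_cemetery t : 0 <= t -> cond_law P X mu t None = 0.
Proof.
move=> t0; rewrite /cond_law (_ : _ `&` _ = set0).
  by rewrite {1}/law esum1 ?mul0r// => x _; rewrite measure0 mule0.
apply/seteqP; split => w //= [].
rewrite /killed /survival /= => + tT; rewrite tT.
have nD : ~ D (X t w).
  have : survival X D t w by exact: tT.
  by rewrite (survivalE D hX t0); apply; rewrite t0 add0r lexx.
by case: insubP => // /negP nE _; apply: nE; rewrite inE.
Qed.

Lemma rowmul_semigroup t k : 0 <= t ->
  rowmul (vec mu) (killed_semigroup P X t) k =
  (if k is Some y then mixed_prob [set val y] t else 1 - mixed_prob setT t)%:E.
Proof.
move=> t0; transitivity (xsum (fun i => (mu i * state_semigroup t i k)%:E)).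
  by congr xsum; apply/funext => i; rewrite (killed_semigroupE hX)// EFinM.
case: k => [y|]; first exact: mixed_prob_has_sum.
apply: eq_has_sum (has_sumB distribution_has_sum (mixed_prob_has_sum setT t0))
  => i /=.
by rewrite mulrBr mulr1.
Qed.

(** The cemetery is absorbing, so [delta P^T(t) = delta]; subtracting it turns the cemetery entry
    [1 - mixed_prob mu setT t] into [- mixed_prob mu setT t]. *)
Lemma rowmul_drift alpha t k : 0 <= t ->
  rowmul (drift alpha mu) (killed_semigroup P X t) k =
  (alpha * (if k is Some y then mixed_prob [set val y] t else - mixed_prob setT
    t))%:E.
Proof.
move=> t0.
have h0 : has_sum (fun i => mu i * state_semigroup t i k) (if k is Some y then
  mixed_prob [set val y] t else 1 - mixed_prob setT t).
  rewrite /has_sum -(rowmul_semigroup k t0).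
  by congr xsum; apply/funext => i; rewrite (killed_semigroupE hX)// EFinM.
have h1 : has_sum (fun i => (i == None)%:R *
  state_semigroup t i k) (k == None)%:R.
  have := @has_sum1 R _ None (fun i => (i == None)%:R * state_semigroup t i k).
  rewrite eqxx mul1r (_ : state_semigroup t None k = (k == None)%:R);
    last first.
    by case: k {h0} => //=; rewrite subr0.
  by apply=> i /negbTE ->; rewrite mul0r.
transitivity (xsum (fun i => (alpha * (mu i *
  state_semigroup t i k - (i == None)%:R * state_semigroup t i k))%:E)).
  congr xsum; apply/funext => i; rewrite (killed_semigroupE hX)// /drift -EFinM.
  by congr EFin; ring.
rewrite (has_sumZ alpha (has_sumB h0 h1)); congr (_ * _)%:E.
by case: k {h0 h1} => [y|] /=; rewrite ?subr0//; ring.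
Qed.

End OneLaw.

(** * Quasi-stationarity of the quasi-limiting distribution *)

Section Yaglom.
Variables (mu pi : state -> R) (alpha : R).
Hypothesis hmu : distribution_on mu.
Hypothesis hexp : forall t, 0 <= t -> law P mu (survival X D t) =
  (expR (- (alpha * t)))%:E.
Hypothesis hpi : quasi_limiting P X mu pi.

Lemma mixed_prob_expR t : 0 <= t -> mixed_prob mu setT t = expR (- (alpha * t)).
Proof. by move=> t0; apply: EFin_inj; rewrite -hexp// law_survival. Qed.

Lemma yaglom_cvg y : (fun t => expR (alpha * t) *
  mixed_prob mu [set val y] t) @ +oo --> pi (Some y).
Proof.
have [_ /(_ (Some y)) c] := hpi; apply: cvg_trans c; apply: near_eq_cvg.
near=> t; have t0 : 0 <= t by near: t; exact: nbhs_pinfty_ge.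
by rewrite cond_law_live// mixed_prob_expR// expRN invrK mulrC.
Unshelve. all: by end_near.
Qed.

(** The majorant [expR (alpha * s) * mixed_prob mu [set val y] s] has total mass exactly 1 for every
    [s >= 0], and so has its limit [pi], so that no mass escapes and Pratt's lemma applies to the
    Chapman-Kolmogorov sum. *)
Lemma yaglom_cvg_killed_prob B t : 0 <= t ->
  (fun s => expR (alpha * s) * mixed_prob mu B (s + t)) @ +oo -->
    mixed_prob pi B t.
Proof.
move=> t0; have [hpid _] := hpi.
apply: (@pratt R _ _ +oo (fun s y => expR (alpha * s) *
  mixed_prob mu [set val y] s)
  (fun s y => expR (alpha * s) * mixed_prob mu [set val y] s *
    killed_prob P X D B t (val y)) (fun=> 1) _
  (fun y => pi (Some y)) (fun y => pi (Some y) *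
    killed_prob P X D B t (val y)) 1).
- near=> s; have s0 : 0 <= s by near: s; exact: nbhs_pinfty_ge.
  split.
  + move=> y; have h : 0 <= expR (alpha * s) * mixed_prob mu [set val y] s.
      by rewrite mulr_ge0 ?expR_ge0 ?mixed_prob_ge0.
    by rewrite mulr_ge0 ?killed_prob_ge0//= ler_piMr// (killed_prob_le1 D hX).
  + have := has_sumZ (expR (alpha * s)) (mixed_prob_total hmu s0).
    by rewrite mixed_prob_expR// -expRD subrr expR0.
  + apply: eq_has_sum (has_sumZ (expR (alpha *
    s)) (mixed_prob_CK hmu B s0 t0)) => y.
    by rewrite mulrA.
- exact: yaglom_cvg.
- by move=> y; apply: cvgM; [exact: yaglom_cvg|exact: cvg_cst].
- exact: cvg_cst.
- by apply: has_sum_noncemetery (distribution_has_sum hpid); case: hpid.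
- exact: mixed_prob_live.
Unshelve. all: by end_near.
Qed.

Lemma yaglom_survival t : 0 <= t -> mixed_prob pi setT t = expR (- (alpha * t)).
Proof.
move=> t0; apply: (cvg_unique _ (yaglom_cvg_killed_prob (B := setT) t0)) => //.
have c : (fun _ : R => expR (- (alpha * t))) @ +oo --> expR (- (alpha * t)).
  exact: cvg_cst.
apply: cvg_trans c; apply: near_eq_cvg; near=> s; have s0 : 0 <= s by near: s;
  exact: nbhs_pinfty_ge.
by rewrite /= mixed_prob_expR ?addr_ge0// -expRD; congr expR; ring.
Unshelve. all: by end_near.
Qed.

Lemma yaglom_killed_prob t y : 0 <= t -> mixed_prob pi [set val y] t =
  expR (- (alpha * t)) * pi (Some y).
Proof.
move=> t0; apply: (cvg_unique _ (yaglom_cvg_killed_prob (B :=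
  [set val y]) t0)) => //.
(* The same family, rewritten with [expR (alpha * s) = expR (- (alpha * t)) * expR (alpha * (s +
   t))], is a shift of the one that defines [pi]. *)
have c : (fun s => expR (- (alpha * t)) *
    (expR (alpha * (s + t)) * mixed_prob mu [set val y] (s + t))) @ +oo -->
    expR (- (alpha * t)) * pi (Some y).
  apply: cvgM; first exact: cvg_cst.
  apply: (cvg_comp (fun s => s + t) (fun u =>
    expR (alpha * u) * mixed_prob mu [set val y] u) _ (@yaglom_cvg y)).
  exact: cvg_addrr.
apply: cvg_trans c; apply: near_eq_cvg; apply: nearW => s.
by rewrite /= mulrA -expRD; congr (expR _ * _); ring.
Qed.

Lemma yaglom_quasi_stationary : quasi_stationary P X pi.
Proof.
have [hpid _] := hpi; split => // t [y|] t0; last first.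
  by rewrite cond_law_cemetery//; case: hpid.
rewrite cond_law_live// yaglom_survival// yaglom_killed_prob// mulrC mulKf//.
by rewrite gt_eqF// expR_gt0.
Qed.

End Yaglom.
End Mixture.

(** * The integral formula *)
Section IntegralFormula.
Variables (R : realType) (d : measure_display) (Omega : measurableType d).
Variables (S : countType) (P : S -> probability Omega R) (X : R -> Omega -> S).
Variables (Q : S -> S -> R) (D : set S).
Hypothesis hX : markov_chain P X Q.
Local Notation live := {i | i \in ~` D}.
Local Notation state := (option live).
Local Notation mixed_prob := (@mixed_prob R d Omega S P X D).
Local Notation killed_prob_state := (@killed_prob_state R d Omega S P X D).
Local Notation state_semigroup := (@state_semigroup R d Omega S P X D).
Local Notation state_generator := (@state_generator R d Omega S P X Q D).
Local Notation state_qmatrix := (@state_qmatrix R S Q D).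
Local Notation generator_state := (@generator_state R d Omega S P X Q D).
Variables (mu pi : state -> R) (alpha : R).
Hypothesis hmu : distribution_on mu.
Hypothesis halpha : 0 < alpha.
Hypothesis hexp : forall t, 0 <= t -> law P mu (survival X D t) =
  (expR (- (alpha * t)))%:E.
Hypothesis hderiv : derivative_commutes P X mu.
Hypothesis hpi : quasi_limiting P X mu pi.
Implicit Types (i j k : state) (x y : live) (B : set S) (s t : R).

Let f k t := fine (rowmul (vec mu) (killed_semigroup P X t) k).

Lemma mu_state_generator_has_sum t k : 0 < t -> has_sum (fun i =>
  mu i * state_generator t i k) (derive1 (f k) t).
Proof.
move=> t0; have [_ E] := hderiv k t0.
rewrite /has_sum /f E /rowmul; congr xsum; apply/funext => i.
by rewrite (killed_semigroup_derivE hX)// EFinM.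
Qed.

(** The backward equation turns [Q^T P^T(t)] into the derivative of [P^T(t)], and the hypothesis on
    [mu] takes the derivative out of the sum. *)
Lemma matrix_firstE t k : 0 < t -> matrix_first P X Q alpha mu t k =
  ((derive1 (f k) t + alpha * (if k is Some y then mixed_prob mu [set val y] t
    else - mixed_prob mu setT t))
   * expR (alpha * t))%:E.
Proof.
move=> t0; have t00 := ltW t0.
rewrite /matrix_first (rowmul_drift hX hmu)//.
rewrite (_ : rowmul _ _ _ = (derive1 (f k) t)%:E) -?EFinD -?EFinM//.
rewrite -(mu_state_generator_has_sum k t0) /rowmul; congr xsum;
  apply/funext => i.
by rewrite (matmul_backward hX)// EFinM.
Qed.

(** The cemetery entry of [mu P^T(t)] is [1 - e^(- alpha t)]; its derivative [alpha e^(- alpha t)]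
    cancels the drift. *)
Lemma matrix_first_cemetery t : 0 < t -> matrix_first P X Q alpha mu t None =
  0%E.
Proof.
move=> t0; have t00 := ltW t0; rewrite matrix_firstE//.
have fd : is_derive t (1 : R) (f None) (alpha * expR (- (alpha * t))).
  have h : is_derive t (1 : R) (fun s =>
    1 - expR (- (alpha * s))) (alpha * expR (- (alpha * t))).
    have h1 : is_derive t (1 : R) (fun s : R => - (alpha * s)) (- alpha).
      apply: is_deriveN; rewrite -[X in is_derive _ _ _ X]mulr1.
      exact: (@is_deriveZ _ _ _ (fun s : R => s) alpha).
    have h2 := @is_derive1_comp _ (@expR R) (fun s : R =>
      - (alpha * s)) t _ _ (is_derive_expR _) h1.
    have h3 : is_derive t (1 : R) (fun=> 1 : R) 0 by exact: is_derive_cst.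
    have h4 := is_deriveB h3 h2.
    by rewrite mulrN sub0r opprK mulrC in h4.
  apply: near_eq_is_derive h; near=> s.
  have s0 : 0 < s by near: s; exact: lt_nbhsr.
  by rewrite /f (rowmul_semigroup hX hmu) ?ltW//= (mixed_prob_expR hX hmu hexp)
    ?ltW.
have -> : derive1 (f None) t = alpha * expR (- (alpha * t)).
  by rewrite derive1E; have [] := fd.
by rewrite (mixed_prob_expR hX hmu hexp)// mulrN subrr mul0r.
Unshelve. all: by end_near.
Qed.

(** The version frozen at negative times is continuous on the whole line, as [termwise_integral]
    requires. *)
Let killed_probx_state B t i := if i is Some x then killed_probx P X D B t (val
  x) else 0.

Let killed_probx_state_E B t i : 0 <= t -> killed_probx_state B t i =
  killed_prob_state B t i.
Proof. by case: i => //= x t0; rewrite killed_probx_ge. Qed.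

Lemma matrix_first_integral y (b : R) : 0 < b ->
  (@lebesgue_measure R).-integrable `[0, b]
    (fun t => matrix_first P X Q alpha mu t (Some y)) /\
  (\int[@lebesgue_measure R]_(t in `[0%R, b]) matrix_first P X Q alpha mu t
    (Some y) =
   (expR (alpha * b) * mixed_prob mu [set val y] b - mu (Some y))%:E)%E.
Proof.
move=> b0; pose B := [set val y].
have mu0 i : 0 <= mu i by case: hmu.
have expc : continuous (fun t : R => expR (alpha * t)).
  move=> t; apply: (@cvg_comp _ _ _ (fun t => alpha * t) (@expR R));
    last exact: continuous_expR.
  by apply: cvgM; [exact: cvg_cst|exact: cvg_id].
have kpxc i : continuous (fun t => killed_probx_state B t i).
  by case: i => [x|] t /=; [exact: (killed_probx_continuous hX)|exact: cvg_cst].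
have genc i : continuous (fun t => generator_state B t i).
  by case: i => [x|] t /=; [exact: (generator_continuous hX)|exact: cvg_cst].
(* [v i] is the derivative of [u i]; [W] and [M] are the corresponding sums against [mu], and [M] is
   the integrand for [t > 0]. *)
pose u i t := expR (alpha * t) * killed_probx_state B t i.
pose v i t := expR (alpha * t) * (alpha * killed_probx_state B t i +
  generator_state B t i).
pose W t := expR (alpha * t) * mixed_prob mu B t.
pose M t := expR (alpha * t) * (alpha * mixed_prob mu B t +
  derive1 (f (Some y)) t).
have E t : 0 < t -> matrix_first P X Q alpha mu t (Some y) = (EFin \o M) t.
  by move=> t0; rewrite matrix_firstE//= /M; congr EFin; rewrite /B; ring.
have mulc (g h : R -> R) : continuous g -> continuous h -> continuous (fun t =>
  g t * h t).
  by move=> gc hc t; apply: cvgM; [exact: gc|exact: hc].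
have uc i : continuous (u i) by exact: mulc.
have vc i : continuous (v i).
  apply: mulc => // t; apply: cvgD; last exact: genc.
  by apply: cvgM; [exact: cvg_cst|exact: kpxc].
have ud i t : 0 < t -> is_derive t (1 : R) (u i) (v i t).
  move=> t0.
  have h1 : is_derive t (1 : R) (fun s : R =>
    expR (alpha * s)) (expR (alpha * t) * alpha).
    have h : is_derive t (1 : R) (fun s : R => alpha * s) alpha.
      rewrite -[X in is_derive _ _ _ X]mulr1.
      exact: (@is_deriveZ _ _ _ (fun s : R => s) alpha).
    exact: (@is_derive1_comp _ (@expR R) (fun s : R =>
      alpha * s) t _ _ (is_derive_expR _) h).
  have h2 : is_derive t (1 : R) (fun s =>
    killed_probx_state B s i) (generator_state B t i).
    apply: near_eq_is_derive (killed_prob_state_is_derive hX B i t0); near=> s.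
    by rewrite killed_probx_state_E// ltW//; near: s; exact: lt_nbhsr.
  have := is_deriveM h1 h2; rewrite /GRing.scale/=.
  rewrite (_ : _ + _ = v i t)//; rewrite /v; ring.
(* The constant [c] is minus the diagonal rate at the target [y], by [generator_ge]; differentiating
   the exponential only adds a nonnegative term. *)
have vu0 i t : 0 <= t -> 0 <= v i t + - Q (val y) (val y) * u i t.
  move=> t0; case: i => [x|]; last by rewrite /u /v /=; lra.
  have := generator_ge hX (@live_notD _ _ x) (@live_notD _ _ y) t0.
  have := killed_probx_ge0 P X D B t (val x).
  rewrite /u /v /= -/B => k0 g0.
  rewrite (_ : _ + _ = expR (alpha * t) * (alpha *
    killed_probx P X D B t (val x)
      + (generator P X Q D B t (val x) - Q (val y) (val y) *
        killed_probx P X D B t (val x)))); last by ring.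
  rewrite mulr_ge0 ?expR_ge0// addr_ge0 ?subr_ge0//.
  by rewrite mulr_ge0// ltW.
have ub i t : 0 <= t <= b -> 0 <= u i t <= expR (alpha * b).
  move=> /andP[t0 tb]; rewrite /u killed_probx_state_E// mulr_ge0 ?expR_ge0
    ?killed_prob_state_ge0//=.
  rewrite -[leRHS]mulr1 ler_pM ?expR_ge0 ?killed_prob_state_ge0
    ?(killed_prob_state_le1 hX)//.
  by rewrite ler_expR ler_wpM2l// ltW.
have Ws t : 0 <= t -> has_sum (fun i => mu i * u i t) (W t).
  move=> t0; apply: eq_has_sum (has_sumZ (expR (alpha *
    t)) (mixed_prob_has_sum hX hmu B t0)) => i.
  by rewrite /u killed_probx_state_E//; ring.
have Ms t : 0 < t -> has_sum (fun i => mu i * v i t) (M t).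
  move=> t0; have t00 := ltW t0.
  have h := has_sumD (has_sumZ alpha (mixed_prob_has_sum hX hmu B t00))
    (mu_state_generator_has_sum (Some y) t0).
  apply: eq_has_sum (has_sumZ (expR (alpha * t)) h) => i.
  by rewrite /v killed_probx_state_E// /state_generator -/B; ring.
have [i1 i2] := termwise_integral mu0 (distribution_has_sum hmu) b0 uc vc ud vu0
  ub Ws Ms.
have [j1 j2] := integrable_eq_pos b0 E i1.
split => //; rewrite j2 i2; congr EFin; rewrite /W mulr0 expR0 mul1r.
by rewrite (mixed_prob_0 hX hmu).
Unshelve. all: by end_near.
Qed.

Let improper_live y :
  improper_integral_is (fun t => matrix_first P X Q alpha mu t (Some y))
    (pi (Some y) - mu (Some y)).
Proof.
split=> [b b0|]; first by have [] := matrix_first_integral y b0.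
have c : (fun b => (expR (alpha * b) * mixed_prob mu [set val y] b - mu (Some
  y))%:E) @ +oo -->
    (pi (Some y) - mu (Some y))%:E.
  apply: cvg_EFin; first exact: nearW.
  by apply: cvgB; [exact: (yaglom_cvg hX hmu hexp hpi)|exact: cvg_cst].
apply: cvg_trans c; apply: near_eq_cvg; near=> b.
have b0 : 0 < b by near: b; exact: nbhs_pinfty_gt.
by have [_ ->] := matrix_first_integral y b0.
Unshelve. all: by end_near.
Qed.

Lemma matrix_first_formula : integral_formula mu pi (matrix_first P X Q alpha
  mu).
Proof.
exists (fun k => pi k - mu k); last by move=> k; rewrite addrC subrK.
case=> [y|]; first exact: improper_live.
have -> : pi None - mu None = 0.
  by case: hmu => _ -> _; case: hpi => -[_ -> _] _; rewrite subrr.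
apply: (@improper_integral_eq_pos _ _ (cst 0%E));
  first exact: matrix_first_cemetery.
split=> [b b0|]; first exact: integrable0.
rewrite (_ : (fun b : R => _) = cst 0%E); first exact: cvg_cst.
by apply/funext => b; rewrite integral0.
Qed.

(** Absolute convergence allows the double series to be summed by columns instead of rows, so the
    two integrands agree at every positive time and share their integrals. *)
Lemma row_first_formula : triple_product_summable P X Q mu ->
  integral_formula mu pi (row_first P X Q alpha mu).
Proof.
move=> tri; have [J hJ piE] := matrix_first_formula.
exists J => // k; apply: improper_integral_eq_pos (hJ k) => t t0.
have t00 := ltW t0.
pose F (p : state * state) := mu p.1 * state_qmatrix p.1 p.2 *
  state_semigroup t p.2 k.
have [r Fr] : exists r, has_sum F r.
  have F0 p : (0 <= `|(F p)%:E|)%E by [].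
  have [|s hs] := @esum_fin_ge0 R _ (fun p => `|(F p)%:E|)%E F0.
    have := tri t k t0; rewrite /summable.
    congr (_ < _)%E; apply: eq_esum => p _.
    by rewrite (killed_qmatrixE hX) (killed_semigroupE hX)// -!EFinM.
  apply: (@dominated_has_sum _ _ F (fun p => `|F p|) s) => //.
  exact/ge0_has_sumE.
have [row [row1 row2]] := has_sum_pair Fr.
have [col [col1 col2]] := has_sum_pair (has_sum_swap Fr).
have rE : has_sum (fun i => mu i * state_generator t i k) r.
  apply: eq_has_sum row2 => i; apply: has_sum_unique (row1 i) _.
  apply: eq_has_sum (has_sumZ (mu i) (state_generator_has_sum hX i k t00)) => j.
  by rewrite /F mulrA.
pose dr j := alpha * (mu j - (j == None)%:R).
pose dv := alpha * (if k is Some y then mixed_prob mu [set val y] t else -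
  mixed_prob mu setT t).
have drE : has_sum (fun j => dr j * state_semigroup t j k) dv.
  rewrite /has_sum /dv -(rowmul_drift hX hmu alpha k t00) /rowmul.
  by congr xsum; apply/funext => j; rewrite (killed_semigroupE hX)// EFinM.
transitivity ((r + dv) * expR (alpha * t))%:E; last first.
  rewrite /matrix_first (rowmul_drift hX hmu)// EFinM EFinD;
    congr ((_ + _) * _)%E.
  rewrite -rE /rowmul; congr xsum; apply/funext => i.
  by rewrite (matmul_backward hX)// EFinM.
rewrite mulrC -(has_sumZ (expR (alpha * t)) (has_sumD col2 drE)) /row_first
  /rowmul.
congr xsum; apply/funext => j; rewrite (killed_semigroupE hX)//.
(* If [p_jk(t) = 0], nothing is known about the [j]-th entry of [mu Q^T], which may be infinite, but
   its product with 0 is 0. Otherwise that entry is recovered by dividing the column sum by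
   [p_jk(t)]. *)
have [p0|p0] := eqVneq (state_semigroup t j k) 0.
  have -> : col j = 0.
    apply: has_sum_unique (col1 j) _; apply: eq_has_sum (has_sum0 _ _) => i.
    by rewrite /F /= p0 mulr0.
  by rewrite p0 mule0 mulr0 addr0 mulr0.
have -> : xsum (fun i => vec mu i * killed_qmatrix Q i j)%E =
  (col j / state_semigroup t j k)%:E.
  rewrite mulrC -(has_sumZ (state_semigroup t j k)^-1 (col1 j)); congr xsum;
    apply/funext => i.
  by rewrite (killed_qmatrixE hX) /F /= -EFinM; congr EFin; field.
rewrite -EFinD -!EFinM; congr EFin; rewrite /dr; field.
exact: p0.
Qed.

End IntegralFormula.

Unset Implicit Arguments.

Theorem corollary4 (R : realType) (d : measure_display)
    (Omega : measurableType d) (S : countType)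
    (P : S -> probability Omega R) (X : R -> Omega -> S) (Q : S -> S -> R)
    (hX : markov_chain P X Q) (D : set S)
    (mu pi : state D -> R) (alpha : R)
    (hmu : distribution_on mu)
    (halpha : 0 < alpha)
    (hexp : forall t : R, 0 <= t ->
       law P mu (survival X D t) = (expR (- (alpha * t)))%:E)
    (hderiv : derivative_commutes P X mu)
    (hpi : quasi_limiting P X mu pi) :
  [/\ integral_formula mu pi (matrix_first P X Q alpha mu),
      triple_product_summable P X Q mu ->
        integral_formula mu pi (row_first P X Q alpha mu)
    & quasi_stationary P X pi].
Proof.
split.
- exact: (matrix_first_formula hX).
- exact: (row_first_formula hX).
- exact: (yaglom_quasi_stationary hX hmu hexp hpi).
Qed.
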